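(* The problem \textsc{Signed Achromatic Number} is NP-hard.
   Context: A signed graph $(G,\sigma)$ is a finite simple graph $G$ with a signature $\sigma:E(G)\to\{-,+\}$. Switching a set $S\subseteq V(G)$ changes the sign of every edge with exactly one end in $S$; two signed graphs on the same underlying graph are equivalent if one is obtained from the other by switching some set of vertices. For $k\ge1$ let $M_k=\{-n,\dots,-1,+1,\dots,+n\}$ if $k=2n$, and $M_k=\{-n,\dots,-1,\pm0,+1,\dots,+n\}$ if $k=2n+1$, where $\pm0$ is a single colour with $-(\pm0)=\pm0$. A $k$-colouring of $(G,\sigma)$ is a map $\phi:V(G)\to M_k$. Let $K_k^*$ be the signed multigraph with vertex set $\{i\ge 0: +i\in M_k\}$ (vertex $0$ standing for colour $\pm0$ when $k$ is odd), in which every two distinct vertices are joined by exactly one positive and one negative edge, and every vertex $i\neq0$ carries exactly one negative loop. Given a $k$-colouring $\phi$, the reduced signed graph $R(G,\sigma,\phi)$ is obtained by (1) switching every vertex with a negative colour $-i$ and recolouring it $+i$; (2) identifying, for each $i$, all vertices of colour $+i$ (resp. $\pm0$) into a single vertex $i$ (resp. $0$), edges inside a class becoming loops; (3) keeping at most one positive and at most one negative edge (or loop) between any two vertices (or at any vertex). The colouring $\phi$ is complete if $R(G,\sigma,\phi)$ is exactly $K_k^*$. The achromatic number $\psi(G,\sigma)$ is the largest $k\ge1$ such that some signed graph equivalent to $(G,\sigma)$ admits a complete $k$-colouring. The decision problem \textsc{Signed Achromatic Number} takes as input a signed graph $(G,\sigma)$ and an integer $k\ge1$, and asks whether $\psi(G,\sigma)\ge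 k$. *)

(* Defs.v *)
From HB Require Import structures.
From mathcomp Require Import all_boot all_order all_algebra.

Set Implicit Arguments.
Unset Strict Implicit.
Unset Printing Implicit Defensive.

Import Order.TTheory GRing.Theory Num.Theory.

Local Open Scope nat_scope.

(** * Polynomial time, NP and NP-hardness (deterministic multi-tape machines) *)

Inductive move := Left | Stay | Right.

(** The tape alphabet is [option (bool + tm_extra)]: [None] is the blank,
    [Some (inl b)] are the input/output bits, [Some (inr a)] the other symbols.
    There are [tm_tapes.+1] tapes; the first one receives the input, the last
    one the output. *)
Record TM := MkTM {
  tm_state : finType;
  tm_extra : finType;
  tm_tapes : nat;
  tm_start : tm_state;
  tm_halt  : pred tm_state;
  tm_delta : tm_state -> {ffun 'I_tm_tapes.+1 -> option (bool + tm_extra)} ->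
             tm_state * {ffun 'I_tm_tapes.+1 -> option (bool + tm_extra) * move}
}.

Definition tm_sym (M : TM) : Type := option (bool + tm_extra M).

(** Tapes are infinite to the right only; cells are numbered from 0. *)
Record config (M : TM) := Config {
  cf_state : tm_state M;
  cf_head  : 'I_(tm_tapes M).+1 -> nat;
  cf_tape  : 'I_(tm_tapes M).+1 -> nat -> tm_sym M
}.

Definition bit_cells (M : TM) (w : seq bool) (j : nat) : tm_sym M :=
  omap inl (onth w j).

Definition init_config (M : TM) (w : seq bool) : config M :=
  Config (tm_start M) (fun _ => 0)
         (fun i j => if i == ord0 then bit_cells M w j else None).

(** Moving left from cell 0 has no effect. *)
Definition move_head (m : move) (h : nat) : nat :=
  match m with Left => h.-1 | Stay => h | Right => h.+1 end.

(** Halted configurations are fixed by [tm_step]. *)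
Definition tm_step (M : TM) (c : config M) : config M :=
  if tm_halt (cf_state c) then c else
  let: (q, act) :=
    tm_delta (cf_state c) [ffun i => cf_tape c i (cf_head c i)] in
  Config q
    (fun i => move_head (act i).2 (cf_head c i))
    (fun i j => if j == cf_head c i then (act i).1 else cf_tape c i j).

(** The output is the word that precedes the first blank of the last tape. *)
Definition has_output (M : TM) (c : config M) (w : seq bool) : Prop :=
  forall j, j <= size w -> cf_tape c ord_max j = bit_cells M w j.

Definition polytime (f : seq bool -> seq bool) : Prop :=
  exists (M : TM) (p : {poly nat}), forall x : seq bool,
    let c := iter p.[size x]%R (@tm_step M) (init_config M x) in
    tm_halt (cf_state c) /\ has_output c (f x).

Definition language := seq bool -> Prop.

Definition in_P (L : language) : Prop :=
  exists f : seq bool -> bool,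
    polytime (fun x => [:: f x]) /\ forall x, L x <-> f x.

(** Self-delimiting pairing: the bits of [x] are doubled, [01] ends [x]. *)
Definition pair_code (x y : seq bool) : seq bool :=
  flatten [seq [:: b; b] | b <- x] ++ [:: false, true & y].

Definition in_NP (L : language) : Prop :=
  exists (V : language) (p : {poly nat}),
    in_P V /\
    forall x, L x <->
      exists u : seq bool, size u <= p.[size x]%R /\ V (pair_code x u).

Definition poly_reducible (L L' : language) : Prop :=
  exists f, polytime f /\ forall x, L x <-> L' (f x).

Definition NP_hard (L : language) : Prop :=
  forall L' : language, in_NP L' -> poly_reducible L' L.

(** * Signed graphs *)

(** Signs multiply as booleans under [addb]. *)
Definition sign := bool.
Definition pos : sign := false.
Definition neg : sign := true.

(** [sedge x y] is [None] when [xy] is not an edge, and [Some s] when [xy] is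
    an edge of sign [s]. *)
Record sgraph (T : finType) := SGraph {
  sedge : T -> T -> option sign;
  sedge_sym : forall x y, sedge x y = sedge y x;
  sedge_irr : forall x, sedge x x = None
}.

Section Switching.
Variables (T : finType) (S : {set T}) (G : sgraph T).

Definition switch_edge (x y : T) : option sign :=
  omap (addb ((x \in S) (+) (y \in S))) (sedge G x y).

Fact switch_edge_sym x y : switch_edge x y = switch_edge y x.
Proof. by rewrite /switch_edge sedge_sym addbC. Qed.

Fact switch_edge_irr x : switch_edge x x = None.
Proof. by rewrite /switch_edge sedge_irr. Qed.

Definition switch : sgraph T := SGraph switch_edge_sym switch_edge_irr.
End Switching.

Definition sg_equiv (T : finType) (G H : sgraph T) : Prop :=
  exists S : {set T}, sedge H =2 sedge (switch S G).

(** * Complete colourings and the achromatic number *)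

(** The colour set M_k, with the integer 0 for the colour +-0. *)
Definition colours (k : nat) : pred int :=
  fun c => (`|c| <= k./2) && ((c != 0%R) || odd k).

Definition colouring (T : finType) (k : nat) (phi : T -> int) : Prop :=
  forall v, phi v \in colours k.

(** [mult i j s] is the number of edges of sign [s] with ends [i] and [j]
    (of loops if [i = j]); it is only meaningful on vertices. *)
Record smultigraph := SMultigraph {
  vert : pred nat;
  mult : nat -> nat -> sign -> nat
}.

Definition same_smultigraph (A B : smultigraph) : Prop :=
  vert A =1 vert B /\
  forall i j s, vert A i -> vert A j -> mult A i j s = mult B i j s.

Definition Kstar (k : nat) : smultigraph :=
  SMultigraph (fun i => Posz i \in colours k)
    (fun i j s => if i == j then (i != 0) && (s == neg) : nat else 1).

(** Identification of the vertices of [H] with the same label [c v]; edges are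
    counted as unordered pairs [A] of vertices of [H]. *)
Definition identify (T : finType) (H : sgraph T) (c : T -> nat) : smultigraph :=
  SMultigraph (fun i => [exists v, c v == i])
    (fun i j s => #|[set A : {set T} | [exists x, exists y,
       [&& A == [set x; y], sedge H x y == Some s, c x == i & c y == j]]]|).

Definition simplify (A : smultigraph) : smultigraph :=
  SMultigraph (vert A) (fun i j s => minn 1 (mult A i j s)).

Definition reduced (T : finType) (G : sgraph T) (phi : T -> int) : smultigraph :=
  simplify
    (identify (switch [set v | (phi v < 0)%R] G) (fun v => `|phi v|)).

Definition complete_colouring (T : finType) (G : sgraph T) (k : nat)
    (phi : T -> int) : Prop :=
  colouring k phi /\ same_smultigraph (reduced G phi) (Kstar k).

Definition has_complete (T : finType) (G : sgraph T) (k : nat) : Prop :=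
  exists H : sgraph T, sg_equiv G H /\
  exists phi : T -> int, complete_colouring H k phi.

(** [m] is the achromatic number of [G]. *)
Definition achromatic_number (T : finType) (G : sgraph T) (m : nat) : Prop :=
  [/\ 1 <= m, has_complete G m &
      forall k, 1 <= k -> has_complete G k -> k <= m].

(** * The decision problem *)

(** Binary digits, least significant first. *)
Definition nat_code (k : nat) : seq bool :=
  [seq odd (k %/ 2 ^ i) | i <- iota 0 (trunc_log 2 k).+1].

Definition edge_code (e : option sign) : seq bool :=
  if e is Some s then [:: true; s] else [:: false; false].

(** The row-major signed adjacency matrix. *)
Definition sgraph_code (n : nat) (G : sgraph 'I_n) : seq bool :=
  flatten [seq edge_code (sedge G i j) | i <- enum 'I_n, j <- enum 'I_n].

Definition instance_code (n : nat) (G : sgraph 'I_n) (k : nat) : seq bool :=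
  pair_code (nat_code k) (sgraph_code G).

(** Strings that encode no instance are rejected. *)
Definition SIGNED_ACHROMATIC_NUMBER : language := fun w =>
  exists (n : nat) (G : sgraph 'I_n) (k : nat),
    [/\ 1 <= k, w = instance_code G k &
        exists m, achromatic_number G m /\ k <= m].

(* Main.v *)
(* A nondeterministic polynomial-time computation is described by Horn clauses
   over facts about states, heads and cells; only the certificate is left open.
   No clause says that facts exclude each other: the facts of the actual run are
   forced, and a final clause forbids every output but acceptance.

   A CNF formula becomes a signed graph on N vertices that is asked for N
   colours. Each nonzero colour class contains an edge, so the classes must form
   a perfect matching. A pendant vertex is forced to be matched with its
   neighbour, the apex; the apex is positively joined to all other vertices, and
   the presence of both signs between its class and every other class forces all
   other matched edges to be positive. The remaining graph has two sides, with
   negative edges inside the right one, so that left vertices (clauses,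
   variables and fillers) are matched with right ones (literals). A clause and a
   variable are not adjacent, hence both signs occur between their classes only
   through a negative left-right edge, which encodes that the chosen literal of
   the clause agrees with the chosen value of the variable.

   The reduction only needs counters bounded by a polynomial. A counter is the
   position of a head on a tape whose cell 0 is marked, so programs that loop
   over arithmetic expressions run on the multi-tape machines in polynomial
   time. *)

From Stdlib Require Import FunctionalExtensionality.
From mathcomp Require Import all_boot all_algebra zify.
Require Import Defs.

Set Implicit Arguments.
Unset Strict Implicit.
Unset Printing Implicit Defensive.

Import GRing.Theory.

Local Open Scope nat_scope.

(** * Unary counter machines *)

(* Register 0 is the position of the head on the input tape. *)
Inductive test := TNonzero of nat | TBit | TInside.

(** Jumps are relative, so a piece of code behaves the same wherever it is placed. *)
Inductive instr :=
  | IInc of nat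
  | IDec of nat
  | IEmit of bool
  | IUnless of test & nat
  | IBack of nat.

Definition regs := nat -> nat.

Definition upd (s : regs) (r v : nat) : regs :=
  fun r' => if r' == r then v else s r'.

Definition test_val (x : seq bool) (s : regs) (t : test) : bool :=
  match t with
  | TNonzero r => s r != 0
  | TBit => nth false x (s 0)
  | TInside => s 0 < size x
  end.

Definition cstep (x : seq bool) (code : seq instr)
    (c : nat * regs * seq bool) : nat * regs * seq bool :=
  let: (pc, s, o) := c in
  match onth code pc with
  | None => c
  | Some (IInc r) => (pc.+1, upd s r (s r).+1, o)
  | Some (IDec r) => (pc.+1, upd s r (s r).-1, o)
  | Some (IEmit b) => (pc.+1, s, rcons o b)
  | Some (IUnless t k) => (if test_val x s t then pc.+1 else pc.+1 + k, s, o)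
  | Some (IBack k) => (pc - k, s, o)
  end.

Definition test_reg (t : test) : nat := if t is TNonzero r then r else 0.

Definition instr_reg (i : instr) : nat :=
  match i with IInc r | IDec r => r | IUnless t _ => test_reg t | _ => 0 end.

Definition max_reg (code : seq instr) : nat := \max_(i <- code) instr_reg i.

Lemma onth_max_reg code pc i : onth code pc = Some i -> instr_reg i <= max_reg code.
Proof.
rewrite /max_reg; elim: code pc => [|j code IH] [|pc] //=; rewrite big_cons.
- by case=> ->; rewrite leq_maxl.
- by move/IH => h; rewrite (leq_trans h) ?leq_maxr.
Qed.

(** * Simulation of counters by tape heads *)

Section CounterTM.
Variable code : seq instr.

Let m := max_reg code.
Let ext : finType := option bool.
Let sym := option (bool + ext).
(** State [None] only marks the cells 0; [Some pc] is a program counter, halting at [size code].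
    Tape [r <= m] carries register [r], and the last tape is the output. *)
Let stt : finType := option 'I_(size code).+1.
Let tape := 'I_m.+2.

(** All positions past the end of the code are the same halting state. *)
Definition ctm_pc (pc : nat) : stt := Some (inord (minn pc (size code))).

(* A cell carrying an extra symbol is cell 0 of its tape; on the input tape
   this symbol also records the first input bit. *)
Definition ctm_test (obs : {ffun tape -> sym}) (t : test) : bool :=
  match t with
  | TNonzero r => if obs (inord r) is Some (inr _) then false else true
  | TBit => match obs ord0 with
            | Some (inl b) | Some (inr (Some b)) => b | _ => false end
  | TInside => match obs ord0 with
            | Some (inl _) | Some (inr (Some _)) => true | _ => false end
  end.

Definition ctm_delta (q : stt) (obs : {ffun tape -> sym}) :
    stt * {ffun tape -> sym * move} :=
  let keep (i : tape) := (obs i, Stay) in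
  let at_reg r mv := [ffun i : tape =>
    if i == r :> nat then (obs i, mv) else keep i] in
  match q with
  | None => (ctm_pc 0, [ffun i : tape =>
      if i == ord_max then keep i else
      if i == ord0 then
        (Some (inr (if obs i is Some (inl b) then Some b else None)), Stay)
      else (Some (inr None), Stay)])
  | Some pc =>
    match onth code pc with
    | None => (q, finfun keep)
    | Some (IInc r) => (ctm_pc pc.+1, at_reg r Right)
    | Some (IDec r) => (ctm_pc pc.+1, at_reg r Left)
    | Some (IEmit b) => (ctm_pc pc.+1, [ffun i : tape =>
        if i == ord_max then (Some (inl b), Right) else keep i])
    | Some (IUnless t k) =>
        (ctm_pc (if ctm_test obs t then pc.+1 else pc.+1 + k), finfun keep)
    | Some (IBack k) => (ctm_pc (pc - k), finfun keep)
    end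
  end.

Definition counter_tm : TM :=
  @MkTM stt ext m.+1 None (fun q => q == Some ord_max) ctm_delta.

(** After the first step only the output tape changes. Its cell 0 is not marked, since it has to
    hold the first output bit. *)
Definition ctm_cells (x o : seq bool) (i : tape) (j : nat) : sym :=
  if i == ord_max then omap inl (onth o j) else
  if i == ord0 then
    if j == 0 then Some (inr (onth x 0)) else omap inl (onth x j)
  else if j == 0 then Some (inr None) else None.

Definition ctm_sim (x : seq bool) (c : config counter_tm)
    (a : nat * regs * seq bool) : Prop :=
  let: (pc, s, o) := a in
  [/\ cf_state c = ctm_pc pc,
      forall i : tape, cf_head c i = if i == ord_max then size o else s i &
      forall i j, cf_tape c i j = ctm_cells x o i j].

Lemma ctm_sim_init x :
  ctm_sim x (tm_step (init_config counter_tm x)) (0, fun=> 0, [::]).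
Proof.
rewrite /tm_step /=; split=> //= [i|i j].
- by rewrite !ffunE; case: ifP => //= _; case: ifP => //= _; case: ifP.
rewrite /ctm_cells !ffunE.
have [->|_] := eqVneq i ord_max; first by rewrite onth0n; case: (j == 0).
have [_|_] := eqVneq i ord0; last by case: (j == 0).
by case: (j == 0) => //=; rewrite /bit_cells; case: (x).
Qed.

Lemma ctm_test_val x c pc s o t : ctm_sim x c (pc, s, o) -> test_reg t <= m ->
  ctm_test [ffun i => cf_tape c i (cf_head c i)] t = test_val x s t.
Proof.
case=> _ hh ht; case: t => [r||] /= hr; rewrite !ffunE ht hh /ctm_cells.
- have hv : (inord r : tape) = r :> nat by rewrite inordK //; lia.
  have -> : (inord r == ord_max :> tape) = false.
    by apply/eqP => /(congr1 val) /=; rewrite hv; lia.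
  rewrite hv; case: eqP => [e|_]; last by case: (s r).
  by case: (s r) => // n; case: (onth x n.+1).
- by rewrite -odflt_onth; have [->|_] := eqVneq (s 0) 0; case: (onth x _).
- by rewrite -onthTE; have [->|_] := eqVneq (s 0) 0; case: (onth x _).
Qed.

(** One instruction costs exactly one machine step; past the end of the code both sides stand
    still. *)
Lemma ctm_sim_step x c a :
  ctm_sim x c a -> ctm_sim x (tm_step c) (cstep x code a).
Proof.
case: a => [[pc s] o] hs; have [hq hh ht] := hs.
rewrite /tm_step /= hq /ctm_pc.
have [hpc|hpc] : size code <= pc \/ pc < size code by lia.
  have -> : inord (minn pc (size code)) = ord_max :> 'I_(size code).+1.
    by apply: val_inj; rewrite /= inordK (minn_idPr hpc).
  by rewrite eqxx onth_default // -hpc; split.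
have hv : (inord (minn pc (size code)) : 'I_(size code).+1) = pc :> nat.
  by move=> *; rewrite inordK (minn_idPl (ltnW hpc)) // ltnS ltnW.
have -> : (Some (inord (minn pc (size code))) == Some (@ord_max (size code))) = false.
  by apply/eqP => -[] /(congr1 val) /=; rewrite hv; lia.
rewrite /ctm_delta hv; case hi: (onth code pc) => [i|]; last first.
  by have := onthTE code pc; rewrite hi hpc.
have hr := onth_max_reg hi.
have keep j k : (if k == cf_head c j then cf_tape c j (cf_head c j)
    else cf_tape c j k) = ctm_cells x o j k.
  by case: eqP => [->|_]; rewrite ht.
case: i hi hr => [r|r|b|t k|k] hi /= hr; split=> //=.
- move=> j; rewrite !ffunE /upd; case: eqP => [e|_]; last by rewrite /= hh.
  rewrite /= hh e; case: eqP => // e'; move: e; rewrite e' /=; rewrite -/m in hr; lia.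
- by move=> j k; rewrite !ffunE; case: (_ == r); rewrite /= keep.
- move=> j; rewrite !ffunE /upd; case: eqP => [e|_]; last by rewrite /= hh.
  rewrite /= hh e; case: eqP => // e'; move: e; rewrite e' /=; rewrite -/m in hr; lia.
- by move=> j k; rewrite !ffunE; case: (_ == r); rewrite /= keep.
- by move=> j; rewrite !ffunE size_rcons; case e: (j == ord_max) => /=; rewrite hh e.
- move=> j k; rewrite !ffunE; case e: (j == ord_max) => /=; last first.
    by rewrite keep /ctm_cells e.
  rewrite hh ht /ctm_cells e -cats1 onth_cat.
  case: (ltngtP k (size o)) => [h|h|->] //; last by rewrite subnn.
  rewrite !onth_default //=; lia.
- by rewrite (ctm_test_val hs).
- by move=> j; rewrite !ffunE hh.
- by move=> i j; rewrite !ffunE keep.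
- by move=> j; rewrite !ffunE hh.
- by move=> i j; rewrite !ffunE keep.
Qed.

Lemma iter_cstep_end x n s o :
  iter n (cstep x code) (size code, s, o) = (size code, s, o).
Proof. by elim: n => //= n ->; rewrite /cstep onth_default. Qed.

Lemma counter_tm_polytime (f : seq bool -> seq bool) (p : {poly nat}) :
  (forall x, exists t s, t <= p.[size x]%R /\
     iter t (cstep x code) (0, fun=> 0, [::]) = (size code, s, f x)) ->
  polytime f.
Proof.
(* The additional step is the one that marks the cells; the steps left after [t] are idle. *)
move=> h; exists counter_tm, (p + 1%:P)%R => x.
have [t [s [ht hx]]] := h x.
have e : (p + 1%:P).[size x]%R = (p.[size x]%R - t + t).+1.
  by rewrite hornerD hornerC [RHS]/= subnK // -addn1.
rewrite e iterSr; set c0 := tm_step _.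
have : ctm_sim x (iter (p.[size x]%R - t + t) (@tm_step counter_tm) c0)
  (iter (p.[size x]%R - t + t) (cstep x code) (0, fun=> 0, [::])).
  elim: (_ + t) => [|n IH]; [exact: ctm_sim_init | exact: ctm_sim_step].
rewrite [X in ctm_sim _ _ X]iterD hx iter_cstep_end => -[hq hh hc]; split.
  rewrite hq /ctm_pc minnn /=; apply/eqP; congr Some; apply: val_inj.
  by rewrite /= inordK.
by move=> j _; rewrite hc /ctm_cells eqxx.
Qed.
End CounterTM.

(** Quantifying over the surrounding code makes fragments composable; [T] is only an upper bound on
    the time, so that bounds may be rounded up. *)
Definition runs (x : seq bool) (c : seq instr) (a b : regs * seq bool)
    (T : nat) : Prop :=
  exists2 t, t <= T & forall pre post,
    iter t (cstep x (pre ++ c ++ post)) (size pre, a.1, a.2)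
      = (size pre + size c, b.1, b.2).

(** The forward jump skips the body and the closing [IBack], which returns to the test. *)
Definition while_code (t : test) (c : seq instr) : seq instr :=
  IUnless t (size c).+1 :: c ++ [:: IBack (size c).+1].

Definition if_code (t : test) (c : seq instr) : seq instr :=
  IUnless t (size c) :: c.

(** * Time-bounded execution of structured code *)

Section Runs.
Variable x : seq bool.
Implicit Types (c : seq instr) (s : regs) (o : seq bool) (a b : regs * seq bool).

Lemma runs_sub c a b b' T T' :
  runs x c a b T -> b = b' -> T <= T' -> runs x c a b' T'.
Proof. by case=> t ht h <- hT; exists t => //; apply: leq_trans hT. Qed.

Lemma runs_nil a : runs x [::] a a 0.
Proof. by exists 0 => // pre post; rewrite addn0. Qed.

Lemma runs_cat c1 c2 a b e T1 T2 :
  runs x c1 a b T1 -> runs x c2 b e T2 -> runs x (c1 ++ c2) a e (T1 + T2).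
Proof.
move=> [t1 h1 r1] [t2 h2 r2]; exists (t2 + t1); first by rewrite addnC leq_add.
move=> pre post; rewrite iterD -catA r1 size_cat addnA -size_cat.
by rewrite catA r2 size_cat.
Qed.

Lemma onth_at pre i c : onth (pre ++ i :: c) (size pre) = Some i.
Proof. by rewrite onth_cat ltnn subnn. Qed.

Lemma runs_cons i c s o s' o' b T :
  (forall pre post, cstep x (pre ++ i :: post) (size pre, s, o)
     = ((size pre).+1, s', o')) ->
  runs x c (s', o') b T -> runs x (i :: c) (s, o) b T.+1.
Proof.
move=> hi r; rewrite -cat1s -add1n; apply: runs_cat r.
by exists 1 => // pre post; rewrite addn1; exact: hi.
Qed.

Lemma runs_inc r c s o b T :
  runs x c (upd s r (s r).+1, o) b T -> runs x (IInc r :: c) (s, o) b T.+1.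
Proof. by apply: runs_cons => pre post; rewrite /cstep onth_at. Qed.

Lemma runs_dec r c s o b T :
  runs x c (upd s r (s r).-1, o) b T -> runs x (IDec r :: c) (s, o) b T.+1.
Proof. by apply: runs_cons => pre post; rewrite /cstep onth_at. Qed.

Lemma runs_emit e s o : runs x [:: IEmit e] (s, o) (s, rcons o e) 1.
Proof.
apply: runs_cons (runs_nil _) => pre post; by rewrite /cstep onth_at.
Qed.

Lemma runs_if_false t c a : ~~ test_val x a.1 t -> runs x (if_code t c) a a 1.
Proof.
move=> /negbTE h; exists 1 => // pre post.
by rewrite /= onth_at h addSnnS.
Qed.

Lemma runs_if_true t c a b T :
  test_val x a.1 t -> runs x c a b T -> runs x (if_code t c) a b T.+1.
Proof.
case: a => s o h; apply: runs_cons => pre post.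
by rewrite /cstep onth_at h.
Qed.

(** [S i] is the state after [i] rounds. A round costs [T] for the body and 2 for the test and the
    jump back; the last, failing test costs 1. *)
Lemma runs_while t c (S : nat -> regs * seq bool) n T :
  (forall i, i < n -> test_val x (S i).1 t /\ runs x c (S i) (S i.+1) T) ->
  ~~ test_val x (S n).1 t ->
  runs x (while_code t c) (S 0) (S n) (n * T.+2).+1.
Proof.
move=> hS hn.
have hend : runs x (while_code t c) (S n) (S n) 1.
  exists 1 => // pre post; rewrite /= onth_at (negbTE hn) /=.
  by rewrite size_cat addn1 addSnnS.
(* Induction on the number [k] of rounds that remain. *)
suff H k : k <= n -> runs x (while_code t c) (S (n - k)) (S n) (k * T.+2).+1.
  by have := H n (leqnn n); rewrite subnn.
elim: k => [|k IH] hk; first by rewrite subn0.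
have [ht [u hu hc]] := hS (n - k.+1) ltac:(lia).
have e : (n - k.+1).+1 = n - k by lia.
rewrite e in hc.
have [v hv hw] := IH (ltnW hk).
exists (v + (1 + (u + 1))); first by rewrite mulSn; lia.
move=> pre post; rewrite iterD iterD [iter (u + 1) _ _]iterD.
set code := pre ++ _ ++ post.
have -> : iter 1 (cstep x code) (size pre, (S (n - k.+1)).1, (S (n - k.+1)).2)
  = ((size pre).+1, (S (n - k.+1)).1, (S (n - k.+1)).2).
  by rewrite /= /code /= onth_at ht.
have ecode : code = (pre ++ [:: IUnless t (size c).+1]) ++ c ++
    IBack (size c).+1 :: post.
  by rewrite /code /while_code /= -!catA.
have -> : iter u (cstep x code) ((size pre).+1, (S (n - k.+1)).1, (S (n - k.+1)).2)
  = ((size pre).+1 + size c, (S (n - k)).1, (S (n - k)).2).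
  by have := hc (pre ++ [:: IUnless t (size c).+1]) (IBack (size c).+1 :: post);
    rewrite -ecode size_cat addn1.
have -> : iter 1 (cstep x code) ((size pre).+1 + size c, (S (n - k)).1, (S (n - k)).2)
  = (size pre, (S (n - k)).1, (S (n - k)).2).
  have := onth_at ((pre ++ [:: IUnless t (size c).+1]) ++ c) (IBack (size c).+1) post.
  rewrite -catA -ecode !size_cat addn1 => ho.
  rewrite /iter /cstep ho; congr (_, _, _); lia.
exact: hw.
Qed.
End Runs.

Ltac upd_tac := apply: functional_extensionality => ?; rewrite /upd;
  repeat (case: eqP => [?|?]); subst; try lia; try congruence.

Section Loops.
Variables (x : seq bool).
Implicit Types (s : regs) (o : seq bool).

Definition clear_code d := while_code (TNonzero d) [:: IDec d].

Lemma runs_clear d s o : runs x (clear_code d) (s, o) (upd s d 0, o) (3 * s d).+1.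
Proof.
have := @runs_while x (TNonzero d) [:: IDec d] (fun i => (upd s d (s d - i), o)) (s d) 1.
case=> [i hi||t ht h].
- split; first by rewrite /= /upd eqxx subn_eq0 -ltnNge.
  by apply: runs_dec; apply: runs_sub (runs_nil _ _) _ _ => //; congr pair; upd_tac.
- by rewrite /= /upd eqxx subnn.
exists t; first lia.
move=> pre post; have := h pre post; rewrite /= subn0 subnn.
by have -> : upd s d (s d) = s by upd_tac.
Qed.

Definition move_code d e := while_code (TNonzero d) [:: IDec d; IInc e].

Lemma runs_move d e s o : d <> e ->
  runs x (move_code d e) (s, o) (upd (upd s d 0) e (s e + s d), o) (4 * s d).+1.
Proof.
move=> hde; have nde : (d == e) = false by apply/eqP.
have := @runs_while x (TNonzero d) [:: IDec d; IInc e]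
  (fun i => (upd (upd s d (s d - i)) e (s e + i), o)) (s d) 2.
case=> [i hi||t ht h].
- split; first by rewrite /= /upd nde eqxx subn_eq0 -ltnNge.
  by apply: runs_dec; apply: runs_inc; apply: runs_sub (runs_nil _ _) _ _ => //;
    congr pair; upd_tac.
- by rewrite /= /upd nde eqxx subnn.
exists t; first lia.
move=> pre post; have := h pre post; rewrite /= subn0 subnn addn0.
by have -> : upd (upd s d (s d)) e (s e) = s by upd_tac.
Qed.
End Loops.

(** * Arithmetic expressions and polynomial-time output programs *)

(** All iteration goes through [ESum] and [PFor], whose number of rounds is fixed in advance and
    whose body does not see what has been accumulated; this keeps values and times polynomial.
    Products, quotients and comparisons are derived. *)
Inductive expr :=
  | EVar of nat
  | ECst of nat
  | ESize
  | EBit of expr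
  | EAdd of expr & expr
  | ESub of expr & expr
  | ESum of expr & expr.

Inductive prog :=
  | PEmit of bool
  | PSeq of prog & prog
  | PIf of expr & prog
  | PFor of expr & prog.

(* De Bruijn indices: [ESum a b] and [PFor a c] bind variable 0. *)
Definition scons (T : Type) (i : T) (e : nat -> T) : nat -> T :=
  fun n => if n is n'.+1 then e n' else i.

Section Eval.
Variable x : seq bool.

Fixpoint eval (e : nat -> nat) (E : expr) : nat :=
  match E with
  | EVar i => e i
  | ECst c => c
  | ESize => size x
  | EBit a => nth false x (eval e a)
  | EAdd a b => eval e a + eval e b
  | ESub a b => eval e a - eval e b
  | ESum a b => \sum_(i < eval e a) eval (scons (i : nat) e) b
  end.

Fixpoint peval (e : nat -> nat) (c : prog) : seq bool :=
  match c with
  | PEmit b => [:: b]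
  | PSeq c1 c2 => peval e c1 ++ peval e c2
  | PIf a c => if eval e a != 0 then peval e c else [::]
  | PFor a c => flatten [seq peval (scons i e) c | i <- iota 0 (eval e a)]
  end.
End Eval.

(* Variable [i] lives in register [rho i]; registers from [d] on are free. *)
Fixpoint comp (E : expr) (rho : nat -> nat) (d : nat) : seq instr :=
  match E with
  | EVar i => while_code (TNonzero (rho i)) [:: IDec (rho i); IInc d; IInc d.+1]
              ++ move_code d.+1 (rho i)
  | ECst c => nseq c (IInc d)
  | ESize => while_code TInside [:: IInc d; IInc 0] ++ clear_code 0
  | EBit a => comp a rho d ++ move_code d 0 ++ if_code TBit [:: IInc d]
              ++ clear_code 0
  | EAdd a b => comp a rho d ++ comp b rho d.+1 ++ move_code d.+1 d
  | ESub a b => comp a rho d ++ comp b rho d.+1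
                ++ while_code (TNonzero d.+1) [:: IDec d.+1; IDec d]
  | ESum a b => comp a rho d ++
      while_code (TNonzero d)
        (IDec d :: comp b (scons d.+1 rho) d.+3 ++ move_code d.+3 d.+2
           ++ [:: IInc d.+1])
      ++ clear_code d.+1 ++ move_code d.+2 d
  end.

Fixpoint pcomp (c : prog) (rho : nat -> nat) (d : nat) : seq instr :=
  match c with
  | PEmit b => [:: IEmit b]
  | PSeq c1 c2 => pcomp c1 rho d ++ pcomp c2 rho d
  | PIf a c => comp a rho d ++
      if_code (TNonzero d) (clear_code d ++ pcomp c rho d)
  | PFor a c => comp a rho d ++
      while_code (TNonzero d)
        (IDec d :: pcomp c (scons d.+1 rho) d.+2 ++ [:: IInc d.+1])
      ++ clear_code d.+1
  end.

(** One function bounds both the value and the running time, where [B] bounds the input length and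
    all variables. Below a binder the index is at most [A], whence [B + A]; the factor 10 absorbs
    the overhead of the loops. *)
Fixpoint bnd (E : expr) (B : nat) : nat :=
  match E with
  | EVar _ | ESize => 10 * B + 10
  | ECst c => c
  | EBit a => 10 * bnd a B + 10
  | EAdd a b | ESub a b => 10 * (bnd a B + bnd b B) + 10
  | ESum a b => let A := bnd a B in 10 * (A * bnd b (B + A) + A) + 10
  end.

Fixpoint pbnd (c : prog) (B : nat) : nat :=
  match c with
  | PEmit _ => 1
  | PSeq c1 c2 => pbnd c1 B + pbnd c2 B
  | PIf a c => 10 * (bnd a B + pbnd c B) + 10
  | PFor a c => let A := bnd a B in 10 * (A * pbnd c (B + A) + A) + 10
  end.

(** * Functions given by polynomials *)

Definition is_poly (f : nat -> nat) : Prop :=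
  exists p : {poly nat}, forall n, f n = p.[n]%R.

Lemma is_poly_ext f g : f =1 g -> is_poly f -> is_poly g.
Proof. by move=> e [p hp]; exists p => n; rewrite -e. Qed.

Lemma is_poly_cst c : is_poly (fun=> c).
Proof. by exists (c%:P)%R => n; rewrite hornerC. Qed.

Lemma is_poly_id : is_poly id.
Proof. by exists ('X)%R => n; rewrite hornerX. Qed.

Lemma is_poly_add f g : is_poly f -> is_poly g -> is_poly (fun n => f n + g n).
Proof. by move=> [p hp] [q hq]; exists (p + q)%R => n; rewrite hornerD -hp -hq. Qed.

Lemma is_poly_mul f g : is_poly f -> is_poly g -> is_poly (fun n => f n * g n).
Proof. by move=> [p hp] [q hq]; exists (p * q)%R => n; rewrite hornerM -hp -hq. Qed.

Lemma is_poly_comp f g : is_poly f -> is_poly g -> is_poly (fun n => f (g n)).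
Proof.
by move=> [p hp] [q hq]; exists (p \Po q)%R => n; rewrite horner_comp -hq -hp.
Qed.

Ltac poly_tac := repeat first
  [ assumption | apply: is_poly_cst | apply: is_poly_id
  | apply: is_poly_add | apply: is_poly_mul ].

Lemma is_poly_bnd E : is_poly (bnd E).
Proof.
elim: E => [i|c||a IHa|a IHa b IHb|a IHa b IHb|a IHa b IHb] /=; poly_tac;
  by apply: (is_poly_comp IHb); poly_tac.
Qed.

Lemma is_poly_pbnd c : is_poly (pbnd c).
Proof.
elim: c => [b|c1 IH1 c2 IH2|a c IH|a c IH] /=; poly_tac; try exact: is_poly_bnd;
  by apply: (is_poly_comp IH); poly_tac; exact: is_poly_bnd.
Qed.

Lemma runs_while_eq x t c (S : nat -> regs * seq bool) n T a b T' :
  a = S 0 -> S n = b -> (n * T.+2).+1 <= T' ->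
  (forall i, i < n -> test_val x (S i).1 t /\ runs x c (S i) (S i.+1) T) ->
  ~~ test_val x (S n).1 t -> runs x (while_code t c) a b T'.
Proof.
by move=> -> <- hT h1 h2; apply: runs_sub (runs_while h1 h2) _ hT.
Qed.

Ltac reg_tac hs hv := congr pair; upd_tac;
  first [ by rewrite hv; lia | by rewrite hs; lia | by rewrite !hs; lia | lia ].

(** * Correctness and running time of the compiler *)

Section Compile.
Variable x : seq bool.

(** Register 0 stores no variable, being the input head, and rests at 0 between evaluations. Free
    registers are empty, so that results can be built by increments. *)
Definition good (B : nat) (e : nat -> nat) (rho : nat -> nat) (d : nat) (s : regs) :=
  [/\ size x <= B, forall i, e i <= B, s 0 = 0,
      forall i, 0 < rho i < d & (forall r, d <= r -> s r = 0) /\ forall i, s (rho i) = e i].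

Lemma good_dS B e rho d s v : good B e rho d s -> good B e rho d.+1 (upd s d v).
Proof.
case=> h1 h2 h3 h4 [h5 h6]; have d0 : 0 < d by have := h4 0; lia.
split=> //.
- by rewrite /upd; case: eqP => // e0; lia.
- by move=> i; have := h4 i; lia.
split=> [r hr|i]; rewrite /upd; case: eqP => e0 //; try lia.
- by apply: h5; lia.
- by have := h4 i; lia.
Qed.

(** Used on entering a loop body, whose new variable is the index kept in register [d.+1]. *)
Lemma good_bind B A e rho d s d' s' k :
  good B e rho d s -> k <= A -> d.+1 < d' -> (forall r, r < d -> s' r = s r) ->
  s' d.+1 = k -> (forall r, d' <= r -> s' r = 0) ->
  good (B + A) (scons k e) (scons d.+1 rho) d' s'.
Proof.
case=> h1 h2 h3 h4 [h5 h6] hk hd hs hs1 hs2.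
have d0 : 0 < d by have := h4 0; lia.
split; [lia| |by rewrite hs| |split=> //].
- by case=> [|i] /=; [lia | have := h2 i; lia].
- by case=> [|i] /=; [lia | have := h4 i; lia].
- by case=> [|i] //=; rewrite hs // ?h6; have := h4 i; lia.
Qed.

(** Value and time are bounded in one induction, because the number of rounds of a loop is itself a
    value. *)
Lemma comp_ok E B e rho d s o : good B e rho d s ->
  eval x e E <= bnd E B /\
  runs x (comp E rho d) (s, o) (upd s d (eval x e E), o) (bnd E B).
Proof.
elim: E B e rho d s o => [i|c||a IHa|a IHa b IHb|a IHa b IHb|a IHa b IHb] B e rho d s o hg;
  have [hx he s0 hr [hs hv]] := hg; rewrite [eval _ _ _]/= [bnd _ _]/=;
  rewrite -?/(10 * _).
(* Reading a register in unary empties it: the variable is moved into two registers, and one copy is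
   moved back. *)
- have hi := he i; have [r0 rd] := andP (hr i); split; first lia.
  apply: (@runs_sub _ _ _ _ _ ((5 * e i).+1 + (4 * e i).+1)) => //; last lia.
  pose s1 := upd (upd (upd s (rho i) 0) d (e i)) d.+1 (e i).
  apply: (@runs_cat _ _ _ _ (s1, o)).
    apply: (@runs_while_eq _ _ _ (fun k => (upd (upd (upd s (rho i) (e i - k)) d k)
      d.+1 k, o)) (e i) 3) => //; try lia.
    + by reg_tac hs hv.
    + by congr pair; rewrite /s1 subnn.
    + move=> k hk; split; first by rewrite /= /upd; repeat case: eqP; lia.
      apply: runs_dec; apply: runs_inc; apply: runs_inc.
      by apply: runs_sub (runs_nil _ _) _ _ => //; congr pair; upd_tac.
    + by rewrite /= /upd; repeat case: eqP => /=; lia.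
  apply: runs_sub (runs_move _ _ _ _) _ _; first lia.
  + by rewrite /s1; reg_tac hs hv.
  + by rewrite /s1 /upd eqxx.
- split=> //.
  have H k : runs x (nseq c (IInc d)) (upd s d k, o) (upd s d (k + c), o) c.
    elim: c k => [|c IH] k /=.
      by apply: runs_sub (runs_nil _ _) _ _ => //; rewrite addn0.
    apply: runs_inc.
    have -> : upd (upd s d k) d (upd s d k d).+1 = upd s d k.+1 by upd_tac.
    by rewrite -addSnnS; apply: IH.
  have := H 0; rewrite add0n.
  by have -> : upd s d 0 = s by upd_tac; rewrite hs.
(* The input head walks to the first cell after the input while [d] counts, then returns. *)
- have d0 : 0 < d by have := hr 0; lia.
  split; first lia.
  apply: (@runs_sub _ _ _ _ _ ((4 * size x).+1 + (3 * size x).+1)) => //; last lia.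
  apply: (@runs_cat _ _ _ _ (upd (upd s d (size x)) 0 (size x), o)).
    apply: (@runs_while_eq _ _ _ (fun k => (upd (upd s d k) 0 k, o)) (size x) 2) => //;
      try lia.
    + by reg_tac hs hs.
    + move=> k hk; split; first by rewrite /= /upd /=.
      apply: runs_inc; apply: runs_inc.
      by apply: runs_sub (runs_nil _ _) _ _ => //; congr pair; upd_tac.
    + by rewrite /= /upd /= ltnn.
  by apply: runs_sub (runs_clear _ _ _ _) _ _ => //; congr pair; upd_tac.
(* The head goes to position [v], tests the bit there and returns. *)
- have d0 : 0 < d by have := hr 0; lia.
  have [ha ra] := IHa _ _ _ _ _ o hg; split; first by case: nth; lia.
  set v := eval x e a in ha ra *; set A := bnd a B in ha ra *.
  apply: (@runs_sub _ _ _ _ _ (A + ((4 * v).+1 + (2 + (3 * v).+1)))) => //; last lia.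
  apply: runs_cat ra _.
  apply: (@runs_cat _ _ _ _ (upd s 0 v, o)).
    apply: runs_sub (runs_move _ _ _ _) _ _; first lia.
    + by reg_tac hs s0.
    + by rewrite /upd eqxx.
  apply: (@runs_cat _ _ _ _ (upd (upd s 0 v) d (nth false x v), o)).
    case h: (nth false x v).
      apply: runs_if_true; first by rewrite /= /upd /= h.
      apply: runs_inc; apply: runs_sub (runs_nil _ _) _ _ => //.
      by reg_tac hs hs.
    apply: (@runs_sub _ _ _ (upd s 0 v, o) _ 1) => //.
      by apply: runs_if_false; rewrite /= /upd /= h.
    by reg_tac hs hs.
  apply: runs_sub (runs_clear _ _ _ _) _ _.
  + by reg_tac s0 s0.
  + by rewrite /upd; case: eqP => //; lia.
- have [ha ra] := IHa _ _ _ _ _ o hg.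
  have [hb rb] := IHb _ _ _ _ _ o (good_dS (eval x e a) hg); split; first lia.
  apply: (@runs_sub _ _ _ _ _ (bnd a B + (bnd b B + (4 * eval x e b).+1))) => //;
    last lia.
  apply: runs_cat ra _; apply: runs_cat rb _.
  apply: runs_sub (runs_move _ _ _ _) _ _; first lia.
  + by reg_tac hs hs.
  + by rewrite /upd eqxx.
- have [ha ra] := IHa _ _ _ _ _ o hg.
  have [hb rb] := IHb _ _ _ _ _ o (good_dS (eval x e a) hg); split; first lia.
  apply: (@runs_sub _ _ _ _ _ (bnd a B + (bnd b B + (4 * eval x e b).+1))) => //;
    last lia.
  apply: runs_cat ra _; apply: runs_cat rb _.
  apply: (@runs_while_eq _ _ _ (fun k => (upd (upd s d (eval x e a - k)) d.+1
    (eval x e b - k), o)) (eval x e b) 2) => //; try lia.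
  + by congr pair; upd_tac.
  + by reg_tac hs hs.
  + move=> k hk; split; first by rewrite /= /upd; repeat case: eqP; lia.
    apply: runs_dec; apply: runs_dec.
    by apply: runs_sub (runs_nil _ _) _ _ => //; congr pair; upd_tac.
  + by rewrite /= /upd; repeat case: eqP => /=; lia.
- have [ha ra] := IHa _ _ _ _ _ o hg.
  set n := eval x e a in ha ra *; set A := bnd a B in ha ra *.
  set C := bnd b (B + A).
  pose f k := \sum_(i < k) eval x (scons (i : nat) e) b.
  have fS k : f k.+1 = f k + eval x (scons k e) b by rewrite /f big_ord_recr.
  (* Register [d] counts the rounds left, [d.+1] is the index and [d.+2] the partial sum. *)
  pose S k := upd (upd (upd s d (n - k)) d.+1 k) d.+2 (f k).
  have hS k : k < n -> good (B + A) (scons k e) (scons d.+1 rho) d.+3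
      (upd (S k) d (n - k).-1).
    move=> hk; apply: (good_bind hg); [lia|lia| | |].
    + by move=> r hrd; rewrite /S /upd; repeat (case: eqP => ?; first lia).
    + by rewrite /S /upd; repeat (case: eqP => ?; try lia).
    + by move=> r hrd; rewrite /S /upd; repeat (case: eqP => ?; first lia); rewrite hs //; lia.
  have hC k : k < n -> eval x (scons k e) b <= C.
    by move=> hk; case: (IHb _ _ _ _ _ o (hS k hk)).
  have hf k : k <= n -> f k <= k * C.
    elim: k => [|k IH] hk; first by rewrite /f big_ord0.
    by rewrite fS mulSn addnC leq_add // ?hC // IH // ltnW.
  have hfn := hf n (leqnn n).
  have hnC : n * C <= A * C by rewrite leq_mul2r ha orbT.
  split; first by rewrite -/(f n); lia.
  apply: (@runs_sub _ _ _ _ _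
    (A + ((n * (5 * C + 4).+2).+1 + ((3 * n).+1 + (4 * f n).+1)))) => //; last first.
    have : n * (5 * C + 4).+2 = 5 * (n * C) + 6 * n by lia.
    by rewrite -/C; lia.
  apply: runs_cat ra _.
  apply: (@runs_cat _ _ _ _ (S n, o)).
    apply: (@runs_while_eq _ _ _ (fun k => (S k, o)) n (5 * C + 4)) => //.
    + by rewrite /S /f big_ord0; reg_tac hs hs.
    + move=> k hk; split; first by rewrite /= /S /upd; repeat case: eqP; lia.
      have [hb rb] := IHb _ _ _ _ _ o (hS k hk).
      rewrite -/C in hb rb.
      apply: (@runs_sub _ _ _ _ _ ((C + ((4 * C).+1 + 1)).+1)) => //; last lia.
      apply: runs_dec.
      have -> : (S k d).-1 = (n - k).-1 by rewrite /S /upd; repeat case: eqP; lia.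
      apply: runs_cat rb _.
      apply: (@runs_cat _ _ _ _ (upd (upd (S k) d (n - k).-1) d.+2 (f k.+1), o)).
        apply: runs_sub (runs_move _ _ _ _) _ _; first lia.
        * by rewrite /S fS; reg_tac hs hs.
        * by rewrite /upd eqxx; lia.
      apply: runs_inc; apply: runs_sub (runs_nil _ _) _ _ => //.
      by congr pair; rewrite /S; upd_tac.
    + by rewrite /= /S /upd; repeat case: eqP => /=; lia.
  apply: (@runs_cat _ _ _ _ (upd (upd s d 0) d.+2 (f n), o)).
    apply: runs_sub (runs_clear _ _ _ _) _ _.
    + by rewrite /S; reg_tac hs hs.
    + by rewrite /S /upd; repeat case: eqP => /=; lia.
  apply: runs_sub (runs_move _ _ _ _) _ _; first lia.
  + by rewrite -/(f n); reg_tac hs hs.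
  + by rewrite /upd; repeat case: eqP => /=; lia.
Qed.

(** A program leaves the registers as it found them, so every round of a loop starts from a state of
    the same form. *)
Lemma pcomp_ok c B e rho d s o : good B e rho d s ->
  runs x (pcomp c rho d) (s, o) (s, o ++ peval x e c) (pbnd c B).
Proof.
elim: c B e rho d s o => [b|c1 IH1 c2 IH2|a c IH|a c IH] B e rho d s o hg;
  have [hx he s0 hr [hs hv]] := hg; rewrite [peval _ _ _]/= [pbnd _ _]/=;
  rewrite -?/(10 * _).
- by rewrite cats1; apply: runs_emit.
- by rewrite catA; apply: runs_cat (IH1 _ _ _ _ _ _ hg) (IH2 _ _ _ _ _ _ hg).
- have [ha ra] := comp_ok a o hg.
  apply: (@runs_sub _ _ _ _ _
    (bnd a B + ((3 * eval x e a).+1 + pbnd c B).+1)) => //; last lia.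
  apply: runs_cat ra _.
  case: ifPn => [h0|/negPn/eqP h0]; last first.
    apply: (@runs_sub _ _ _ (s, o) _ 1) => //; last by rewrite cats0.
    have -> : upd s d (eval x e a) = s by upd_tac; rewrite h0 hs.
    by apply: runs_if_false; rewrite /= hs.
  apply: runs_if_true; first by rewrite /= /upd eqxx.
  apply: (@runs_cat _ _ _ _ (s, o)); last exact: IH hg.
  apply: runs_sub (runs_clear _ _ _ _) _ _; first by reg_tac hs hs.
  by rewrite /upd eqxx.
- have [ha ra] := comp_ok a o hg.
  set n := eval x e a in ha ra *; set A := bnd a B in ha ra *.
  set C := pbnd c (B + A).
  pose f k := flatten [seq peval x (scons i e) c | i <- iota 0 k].
  have fS k : f k.+1 = f k ++ peval x (scons k e) c.
    by rewrite /f -addn1 iotaD map_cat flatten_cat /= cats0.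
  pose S k := upd (upd s d (n - k)) d.+1 k.
  have hS k : k < n -> good (B + A) (scons k e) (scons d.+1 rho) d.+2
      (upd (S k) d (n - k).-1).
    move=> hk; apply: (good_bind hg); [lia|lia| | |].
    + by move=> r hrd; rewrite /S /upd; repeat (case: eqP => ?; first lia).
    + by rewrite /S /upd; repeat (case: eqP => ?; try lia).
    + by move=> r hrd; rewrite /S /upd; repeat (case: eqP => ?; first lia); rewrite hs //; lia.
  have hnC : n * C <= A * C by rewrite leq_mul2r ha orbT.
  apply: (@runs_sub _ _ _ _ _ (A + ((n * (C + 2).+2).+1 + (3 * n).+1))) => //; last first.
    have : n * (C + 2).+2 = n * C + 4 * n by lia.
    by rewrite -/C; lia.
  apply: runs_cat ra _.
  apply: (@runs_cat _ _ _ _ (S n, o ++ f n)).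
    apply: (@runs_while_eq _ _ _ (fun k => (S k, o ++ f k)) n (C + 2)) => //.
    + by rewrite /S /f /= cats0; reg_tac hs hs.
    + move=> k hk; split; first by rewrite /= /S /upd; repeat case: eqP; lia.
      rewrite fS catA.
      apply: (@runs_sub _ _ _ _ _ ((C + 1).+1)) => //; last lia.
      apply: runs_dec.
      have -> : (S k d).-1 = (n - k).-1 by rewrite /S /upd; repeat case: eqP; lia.
      apply: runs_cat (IH _ _ _ _ _ _ (hS k hk)) _.
      apply: runs_inc; apply: runs_sub (runs_nil _ _) _ _ => //.
      by congr pair; rewrite /S; upd_tac.
    + by rewrite /= /S /upd; repeat case: eqP => /=; lia.
  apply: runs_sub (runs_clear _ _ _ _) _ _.
  + by rewrite -/(f n) /S; reg_tac hs hs.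
  + by rewrite /S /upd; repeat case: eqP => /=; lia.
Qed.
End Compile.

Theorem polytime_peval c : polytime (fun x => peval x (fun=> 0) c).
Proof.
have [p hp] := is_poly_pbnd c.
(* Register 1, which holds 0, represents every variable of the initial environment; registers from 2
   on are free. *)
apply: (@counter_tm_polytime (pcomp c (fun=> 1) 2) _ p) => x.
have hg : good x (size x) (fun=> 0) (fun=> 1) 2 (fun=> 0) by [].
have [t ht h] := pcomp_ok c [::] hg.
exists t, (fun=> 0); rewrite -hp; split=> //.
by have := h [::] [::]; rewrite cats0.
Qed.

(** * Definable functions *)

Fixpoint ren (xi : nat -> nat) (E : expr) : expr :=
  match E with
  | EVar i => EVar (xi i)
  | ECst c => ECst c
  | ESize => ESize
  | EBit a => EBit (ren xi a)
  | EAdd a b => EAdd (ren xi a) (ren xi b)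
  | ESub a b => ESub (ren xi a) (ren xi b)
  | ESum a b => ESum (ren xi a) (ren (scons 0 (fun i => (xi i).+1)) b)
  end.

Lemma eval_ren x e e' xi E : (forall i, e' i = e (xi i)) ->
  eval x e (ren xi E) = eval x e' E.
Proof.
elim: E e e' xi => [i|c||a IHa|a IHa b IHb|a IHa b IHb|a IHa b IHb] e e' xi h //=;
  rewrite ?(IHa e e' xi) ?(IHb e e' xi) //.
by apply: eq_bigr => i _; apply: IHb => -[|j] /=.
Qed.

(** Definability is stated for functions rather than expressions, so that it can be derived from the
    shape of an ordinary definition. *)
Definition def (F : seq bool -> (nat -> nat) -> nat) : Prop :=
  exists E, forall x e, eval x e E = F x e.

Definition defb (P : seq bool -> (nat -> nat) -> bool) : Prop :=
  def (fun x e => nat_of_bool (P x e)).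

Definition pdef (F : seq bool -> (nat -> nat) -> seq bool) : Prop :=
  exists c, forall x e, peval x e c = F x e.

Lemma def_ext F G : (forall x e, F x e = G x e) -> def F -> def G.
Proof. by move=> h [E hE]; exists E => x e; rewrite hE. Qed.

Lemma def_var i : def (fun _ e => e i).
Proof. by exists (EVar i). Qed.

Lemma def_cst c : def (fun _ _ => c).
Proof. by exists (ECst c). Qed.

Lemma def_size : def (fun x _ => size x).
Proof. by exists ESize. Qed.

Lemma def_shift a : def a -> def (fun x e => a x (fun i => e i.+1)).
Proof. by case=> E hE; exists (ren S E) => x e; rewrite -hE; apply: eval_ren. Qed.

Lemma defb_bit a : def a -> defb (fun x e => nth false x (a x e)).
Proof. by case=> E hE; exists (EBit E) => x e /=; rewrite hE. Qed.

Lemma def_add a b : def a -> def b -> def (fun x e => a x e + b x e).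
Proof. by move=> [E hE] [E' hE']; exists (EAdd E E') => x e /=; rewrite hE hE'. Qed.

Lemma def_sub a b : def a -> def b -> def (fun x e => a x e - b x e).
Proof. by move=> [E hE] [E' hE']; exists (ESub E E') => x e /=; rewrite hE hE'. Qed.

Lemma def_sum a (b : seq bool -> (nat -> nat) -> nat -> nat) :
  def a -> def (fun x e => b x (fun i => e i.+1) (e 0)) ->
  def (fun x e => \sum_(i < a x e) b x e i).
Proof.
move=> [E hE] [E' hE']; exists (ESum E E') => x e /=; rewrite hE.
by apply: eq_bigr => i _; rewrite hE'.
Qed.

(** A product is a sum of equal terms. *)
Lemma def_mul a b : def a -> def b -> def (fun x e => a x e * b x e).
Proof.
move=> ha hb; apply: (@def_ext (fun x e => \sum_(i < a x e) b x e)).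
  by move=> x e; rewrite sum_nat_const card_ord.
exact: (@def_sum a (fun x e _ => b x e) ha (def_shift hb)).
Qed.

Lemma defb_cst c : defb (fun _ _ => c).
Proof. exact: def_cst. Qed.

Lemma defb_neg P : defb P -> defb (fun x e => ~~ P x e).
Proof.
move=> h; apply: (@def_ext (fun x e => 1 - P x e)); last exact: def_sub (def_cst 1) h.
by move=> x e; case: (P x e).
Qed.

Lemma defb_and P Q : defb P -> defb Q -> defb (fun x e => P x e && Q x e).
Proof.
move=> h h'; apply: (@def_ext (fun x e => P x e * Q x e)); last exact: def_mul.
by move=> x e; case: (P x e); case: (Q x e).
Qed.

Lemma defb_or P Q : defb P -> defb Q -> defb (fun x e => P x e || Q x e).
Proof.
move=> h h'.
apply: (@def_ext (fun x e => nat_of_bool (~~ (~~ P x e && ~~ Q x e)))).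
  by move=> x e; case: (P x e); case: (Q x e).
exact: defb_neg (defb_and (defb_neg h) (defb_neg h')).
Qed.

Lemma defb_leq a b : def a -> def b -> defb (fun x e => a x e <= b x e).
Proof.
move=> ha hb; apply: (@def_ext (fun x e => 1 - (a x e - b x e))).
  by move=> x e; lia.
exact: def_sub (def_cst 1) (def_sub ha hb).
Qed.

Lemma def_succ a : def a -> def (fun x e => (a x e).+1).
Proof.
move=> h; apply: (@def_ext (fun x e => a x e + 1)); first by move=> *; rewrite addn1.
exact: def_add h (def_cst 1).
Qed.

Lemma defb_eqn a b : def a -> def b -> defb (fun x e => a x e == b x e).
Proof.
move=> ha hb.
apply: (@def_ext (fun x e => nat_of_bool ((a x e <= b x e) && (b x e <= a x e)))).
  by move=> x e; rewrite -eqn_leq.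
by apply: defb_and; apply: defb_leq.
Qed.

Lemma def_if P a b : defb P -> def a -> def b ->
  def (fun x e => if P x e then a x e else b x e).
Proof.
move=> hP ha hb.
apply: (@def_ext (fun x e => P x e * a x e + ~~ P x e * b x e)).
  by move=> x e; case: (P x e); rewrite ?mul1n ?mul0n ?addn0.
by apply: def_add; apply: def_mul => //; apply: defb_neg.
Qed.

Lemma defb_if P a b : defb P -> defb a -> defb b ->
  defb (fun x e => if P x e then a x e else b x e).
Proof.
move=> hP ha hb; apply: def_ext (def_if hP ha hb) => x e.
by case: (P x e).
Qed.

Lemma sum_ltn_const n q : q <= n -> \sum_(i < n) ((i : nat) < q) = q.
Proof.
move=> hq; suff -> : \sum_(i < n) ((i : nat) < q) = minn q n by apply/minn_idPl.
by elim: n {hq} => [|n IH]; rewrite ?big_ord0 ?big_ord_recr /= ?IH; lia.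
Qed.

(** The quotient is the number of [i < a] with [(i + 1) * b <= a], when [b] is positive. *)
Lemma def_divn a b : def a -> def b -> def (fun x e => a x e %/ b x e).
Proof.
move=> ha hb.
apply: (@def_ext (fun x e => \sum_(i < a x e)
  ((0 < b x e) && ((i : nat).+1 * b x e <= a x e)))).
  move=> x e; have [->|b0] := posnP (b x e).
    by rewrite divn0 big1.
  rewrite -[RHS](@sum_ltn_const (a x e)) ?leq_div //.
  by apply: eq_bigr => i _; rewrite /= leq_divRL.
apply: (@def_sum a (fun x e i => nat_of_bool ((0 < b x e) && (i.+1 * b x e <= a x e)))) => //.
apply: defb_and; first exact: defb_leq (def_cst 1) (def_shift hb).
apply: defb_leq (def_shift ha); apply: def_mul (def_shift hb).
exact: def_succ (def_var 0).
Qed.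

Lemma def_modn a b : def a -> def b -> def (fun x e => a x e %% b x e).
Proof.
move=> ha hb; apply: (@def_ext (fun x e => a x e - a x e %/ b x e * b x e)).
  by move=> x e; rewrite {1}(divn_eq (a x e) (b x e)) addKn.
by apply: def_sub => //; apply: def_mul => //; apply: def_divn.
Qed.

Lemma defb_odd a : def a -> defb (fun x e => odd (a x e)).
Proof.
move=> ha; apply: (@def_ext (fun x e => a x e %% 2)); first by move=> *; rewrite modn2.
exact: def_modn (def_cst 2).
Qed.

Lemma def_half a : def a -> def (fun x e => (a x e)./2).
Proof.
move=> ha; apply: (@def_ext (fun x e => a x e %/ 2)); first by move=> *; rewrite divn2.
exact: def_divn (def_cst 2).
Qed.

Lemma def_double a : def a -> def (fun x e => (a x e).*2).
Proof.
move=> h; apply: (@def_ext (fun x e => a x e + a x e)); last exact: def_add.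
by move=> *; rewrite addnn.
Qed.

Lemma def_pred a : def a -> def (fun x e => (a x e).-1).
Proof.
move=> h; apply: (@def_ext (fun x e => a x e - 1)); last exact: def_sub (def_cst 1).
by move=> *; rewrite subn1.
Qed.

Lemma defb_eqb P Q : defb P -> defb Q -> defb (fun x e => P x e == Q x e).
Proof.
move=> hP hQ; apply: (@def_ext (fun x e => nat_of_bool (nat_of_bool (P x e) == Q x e))).
  by move=> x e; case: (P x e); case: (Q x e).
exact: defb_eqn.
Qed.

(** The index type does not depend on the input, so the quantifier unfolds to a fixed
    disjunction. *)
Lemma defb_exists (I : finType) (P : I -> seq bool -> (nat -> nat) -> bool) :
  (forall i, defb (P i)) -> defb (fun x e => [exists i, P i x e]).
Proof.
move=> h; apply: (@def_ext (fun x e => nat_of_bool (has (fun i => P i x e) (enum I)))).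
  move=> x e; congr nat_of_bool; apply/hasP/existsP => [[i _ hi]|[i hi]]; exists i => //.
  by rewrite mem_enum.
elim: (enum I) => [|i s IH]; first exact: def_cst.
exact: (@defb_or (P i) _ (h i) IH).
Qed.

Lemma def_poly f a : is_poly f -> def a -> def (fun x e => f (a x e)).
Proof.
move=> [p hp] ha; apply: (@def_ext (fun x e => p.[a x e]%R)).
  by move=> x e; rewrite hp.
elim/poly_ind: p {f hp} => [|p c IH].
  by apply: def_ext (def_cst 0) => x e; rewrite horner0.
apply: (@def_ext (fun x e => p.[a x e]%R * a x e + c)).
  by move=> x e; rewrite hornerMXaddC.
by apply: def_add (def_cst c); apply: def_mul.
Qed.

Lemma pdef_ext F G : (forall x e, F x e = G x e) -> pdef F -> pdef G.
Proof. by move=> h [E hE]; exists E => x e; rewrite hE. Qed.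

Lemma pdef_cat F G : pdef F -> pdef G -> pdef (fun x e => F x e ++ G x e).
Proof. by move=> [E hE] [E' hE']; exists (PSeq E E') => x e /=; rewrite hE hE'. Qed.

Lemma pdef_if P F : defb P -> pdef F -> pdef (fun x e => if P x e then F x e else [::]).
Proof.
move=> [E hE] [E' hE']; exists (PIf E E') => x e /=; rewrite hE hE'.
by case: (P x e).
Qed.

Lemma pdef_bit P : defb P -> pdef (fun x e => [:: P x e]).
Proof.
move=> h; apply: (@pdef_ext (fun x e =>
  (if P x e then [:: true] else [::]) ++ (if ~~ P x e then [:: false] else [::]))).
  by move=> x e; case: (P x e).
by apply: pdef_cat; apply: pdef_if;
  [|exists (PEmit true)|apply: defb_neg|exists (PEmit false)].
Qed.

Lemma pdef_for a (F : seq bool -> (nat -> nat) -> nat -> seq bool) :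
  def a -> pdef (fun x e => F x (fun i => e i.+1) (e 0)) ->
  pdef (fun x e => flatten [seq F x e i | i <- iota 0 (a x e)]).
Proof.
move=> [E hE] [E' hE']; exists (PFor E E') => x e /=; rewrite hE.
by congr flatten; apply: eq_map => i; rewrite hE'.
Qed.

(** Hypotheses are tried first, so that functions already known to be definable are not unfolded;
    their shifted forms serve below binders. *)
Ltac def_step := match goal with
  | h : def _ |- def _ => solve [exact: h]
  | h : def ?a |- def _ => solve [exact: (def_shift h) | exact: (def_shift (def_shift h))]
  | h : is_poly ?f |- def (fun x e => ?f (@?a x e)) => apply: (def_poly h)
  | |- def (fun x e => e ?i) => exact: (def_var i)
  | |- def (fun x e => size x) => exact: def_size
  | |- def (fun x e => @?a x e + @?b x e) => apply: def_add
  | |- def (fun x e => @?a x e - @?b x e) => apply: def_sub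
  | |- def (fun x e => @?a x e * @?b x e) => apply: def_mul
  | |- def (fun x e => @?a x e %/ @?b x e) => apply: def_divn
  | |- def (fun x e => @?a x e %% @?b x e) => apply: def_modn
  | |- def (fun x e => half (@?a x e)) => apply: def_half
  | |- def (fun x e => nat_of_bool (@?P x e)) => change (defb P)
  | |- def (fun x e => (@?a x e).*2) => apply: def_double
  | |- def (fun x e => (@?a x e).-1) => apply: def_pred
  | |- defb (fun x e => ~~ @?a x e) => apply: defb_neg
  | |- defb (fun x e => @?a x e && @?b x e) => apply: defb_and
  | |- defb (fun x e => @?a x e || @?b x e) => apply: defb_or
  | |- defb (fun x e => @?a x e <= @?b x e) => apply: defb_leq
  | |- defb (fun x e => @eq_op bool (@?a x e) (@?b x e)) => apply: defb_eqb
  | |- defb (fun x e => @eq_op nat (@?a x e) (@?b x e)) => apply: defb_eqn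
  | |- defb (fun x e => @eq_op _ (@?a x e) (@?b x e)) => first [apply: defb_eqn | apply: defb_eqb]
  | |- defb (fun x e => odd (@?a x e)) => apply: defb_odd
  | |- defb (fun x e => nth false x (@?a x e)) => apply: defb_bit
  | |- def (fun x e => (@?a x e).+1) => apply: def_succ
  | |- def (fun x e => ?c) => exact: (def_cst c)
  | |- defb (fun x e => ?c) => exact: (defb_cst c)
  | |- def _ => apply: def_if
  | |- defb _ => apply: defb_if
  end.

Ltac def_tac := repeat def_step.

(** * Complete colourings as matchings *)

Lemma minn1_card (T : finType) (A : {set T}) : minn 1 #|A| = (A != set0).
Proof. by rewrite -card_gt0; lia. Qed.

(** Simplification only keeps whether an edge exists, so counting unordered pairs turns into the
    existence of an ordered one. *)
Lemma mult_reduced (T : finType) (G : sgraph T) (phi : T -> int) i j s :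
  mult (reduced G phi) i j s =
  [exists x, exists y, [&& sedge (switch [set v | (phi v < 0)%R] G) x y == Some s,
     `|phi x| == i & `|phi y| == j]].
Proof.
rewrite /= minn1_card; congr nat_of_bool; apply/set0Pn/existsP.
  case=> A; rewrite inE => /existsP[x /existsP[y /and4P[_ h1 h2 h3]]].
  by exists x; apply/existsP; exists y; rewrite h1 h2.
case=> x /existsP[y /and3P[h1 h2 h3]]; exists [set x; y]; rewrite inE.
by apply/existsP; exists x; apply/existsP; exists y; rewrite eqxx h1 h2.
Qed.

(** The switching to an equivalent graph and that of the negative colours compose to a single
    switching [sg]. Conversely all switching can be done beforehand, leaving only nonnegative
    colours. *)
Lemma has_completeP (T : finType) (G : sgraph T) k :
  has_complete G k <-> exists (sg : T -> bool) (c : T -> nat),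
    [/\ forall v, Posz (c v) \in colours k,
        forall i, Posz i \in colours k -> exists v, c v = i &
        forall i j s, Posz i \in colours k -> Posz j \in colours k ->
          (exists x y, [/\ sedge G x y = Some (s (+) (sg x (+) sg y)), c x = i & c y = j])
          <-> (if i == j then (i != 0) && (s == neg) else true)].
Proof.
split.
  case=> H [[S hS]] [phi [hcol [hv hm]]].
  exists (fun v => (v \in S) (+) (phi v < 0)%R), (fun v => `|phi v|).
  have hc v : Posz `|phi v| \in colours k.
    have := hcol v; rewrite !unfold_in /colours /= => /andP[-> h] /=.
    by case: (phi v) h => [[|n]|n].
  split=> // [i hi|i j s hi hj].
    have := hv i; rewrite /= hi => /existsP[v /eqP <-]; by exists v.
  have vi : vert (reduced H phi) i by rewrite hv.
  have vj : vert (reduced H phi) j by rewrite hv.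
  have := hm i j s vi vj; rewrite mult_reduced /Kstar /=.
  set b := if i == j then _ else 1; set b' := if i == j then _ else true.
  have -> : b = b' by rewrite /b /b'; case: (i == j).
  case: existsP => [h|h] /esym; case: b' => // _; split=> //.
    move=> _; have [x /existsP[y /and3P[/eqP h1 /eqP h2 /eqP h3]]] := h.
    exists x, y; split=> //; move: h1; rewrite /= /switch_edge hS /= /switch_edge !inE.
    case: (sedge G x y) => //= a [<-]; congr Some.
    by case: (a); case: (_ \in S); case: (_ \in S); case: (_ < _)%R; case: (_ < _)%R.
  case=> x [y [h1 h2 h3]]; case: h; exists x; apply/existsP; exists y.
  rewrite h2 h3 !eqxx /= /switch_edge hS /= /switch_edge !inE h1 /=.
  by case: (s); case: (_ \in S); case: (_ \in S); case: (_ < _)%R; case: (_ < _)%R.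
case=> sg [c [hc hs he]].
exists (switch [set v | sg v] G); split; first by exists [set v | sg v].
exists (fun v => Posz (c v)); split=> //; split=> [i|i j s].
  rewrite /=; apply/existsP/idP => [[v /eqP <-]|/hs[v <-]]; [exact: hc|by exists v].
rewrite mult_reduced /Kstar /=.
move=> /existsP[vi /eqP hi] /existsP[vj /eqP hj].
have {}hi : Posz i \in colours k by rewrite -hi; apply: hc.
have {}hj : Posz j \in colours k by rewrite -hj; apply: hc.
have H := he i j s hi hj.
set b' := if i == j then _ else true in H.
have -> : (if i == j then nat_of_bool ((i != 0) && (s == neg)) else 1) = b' by rewrite /b'; case: (i == j).
congr nat_of_bool; apply/existsP/idP => [[x /existsP[y /and3P[/eqP h1 /eqP h2 /eqP h3]]]|].
  apply/H; exists x, y; split=> //; move: h1; rewrite /= /switch_edge /= /switch_edge !inE /=.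
  case: (sedge G x y) => //= a [<-]; congr Some.
  by case: (a); case: (sg x); case: (sg y).
case/H=> x [y [h1 h2 h3]]; exists x; apply/existsP; exists y.
rewrite h2 h3 !eqxx /= /switch_edge /= /switch_edge !inE h1 /=.
by case: (s); case: (sg x); case: (sg y).
Qed.

Lemma in_colours k i : (Posz i \in colours k) = (i <= k./2) && ((i != 0) || odd k).
Proof. by rewrite unfold_in. Qed.

(* With at least as many colours as vertices every class is a single edge. *)
Lemma complete_matching (T : finType) (G : sgraph T) k :
  #|T| <= k -> ~~ odd #|T| -> has_complete G k ->
  k = #|T| /\ exists (sg : T -> bool) (mate : T -> T),
    [/\ involutive mate,
        forall v, sedge G v (mate v) = Some (~~ (sg v (+) sg (mate v))) &
        forall u v s, v != u -> v != mate u -> exists x y,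
          [/\ x = u \/ x = mate u, y = v \/ y = mate v &
              sedge G x y = Some (s (+) (sg x (+) sg y))]].
Proof.
move=> hk ho /has_completeP[sg [c [hc hsur he]]].
set n := k./2.
have hcol (i : nat) : 0 < i -> i <= n -> Posz i \in colours k.
  by move=> i0 hi; rewrite in_colours hi -lt0n i0.
(* For each nonzero colour, choose the ends of an edge that yields its negative loop. *)
have /fin_all_exists[f hf] : forall i : 'I_n, exists xy : T * T,
    [/\ sedge G xy.1 xy.2 = Some (neg (+) (sg xy.1 (+) sg xy.2)),
        c xy.1 = i.+1 & c xy.2 = i.+1].
  move=> i; have hi := hcol i.+1 isT (ltn_ord i).
  have [_ H] := he i.+1 i.+1 neg hi hi.
  have [|x [y h]] := H _; first by rewrite eqxx.
  by exists (x, y).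
pose p (q : 'I_n * bool) := if q.2 then (f q.1).1 else (f q.1).2.
have cp q : c (p q) = q.1.+1 by have [_ h1 h2] := hf q.1; rewrite /p; case: q.2.
have p_edge i b : sedge G (p (i, b)) (p (i, ~~ b)) =
    Some (~~ (sg (p (i, b)) (+) sg (p (i, ~~ b)))).
  have [h _ _] := hf i; rewrite /p /=; case: b => //=.
  by rewrite sedge_sym h [sg _ (+) _]addbC.
have p_inj : injective p.
  move=> [i b] [j b'] e; have := cp (i, b); rewrite e cp => -[] /val_inj /= ij.
  rewrite -ij in e *; congr pair; apply/eqP; rewrite -[_ == _]negbK; apply/negP => nb.
  have {nb} nb : b' = ~~ b by case: (b) (b') nb => [] [].
  by have := p_edge j b; rewrite -nb e sedge_irr.
have hcard : #|{: 'I_n * bool}| = n * 2 by rewrite card_prod card_ord card_bool.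
(* The [2n] chosen ends are distinct, and [#|T|] is even and at most [k <= 2n + 1]; so they are all
   the vertices. *)
have hTn : #|T| = n * 2.
  have h1 := leq_card p p_inj; rewrite hcard in h1.
  have h2 := odd_double_half k; rewrite -/n -muln2 in h2.
  by move: hk ho; lia.
have [g gK pK] : bijective p by apply: inj_card_bij p_inj _; rewrite hcard hTn.
(* An odd [k] would require a vertex of colour 0, but every vertex is a chosen end and has a nonzero
   colour. *)
have ek : odd k = false.
  apply/negP => ok; have [|v hv] := hsur 0; first by rewrite in_colours ok.
  by have := cp (g v); rewrite pK hv.
split; first by have := odd_double_half k; rewrite ek -/n hTn -muln2.
pose mate v := p ((g v).1, ~~ (g v).2).
exists sg, mate; split.
- by move=> v; rewrite /mate gK /= negbK -surjective_pairing pK.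
- move=> v; have := p_edge (g v).1 (g v).2.
  by rewrite -surjective_pairing pK; apply.
have cls u v : c u = c v -> u = v \/ u = mate v.
  rewrite -{1}(pK u) -{1}(pK v) !cp => -[] /val_inj h.
  suff : p (g u) = p (g v) \/ p (g u) = p ((g v).1, ~~ (g v).2) by rewrite !pK.
  case: (g u) (g v) h => [i b] [j b'] /= ->.
  by case: b b' => [] []; [left|right|right|left].
have chi v : Posz (c v) \in colours k by apply: hc.
move=> u v s nvu nvm.
have [_ H] := he (c u) (c v) s (chi u) (chi v).
have [|x [y [h1 h2 h3]]] := H _.
  case: eqP => // /esym /cls [e|e]; first by rewrite e eqxx in nvu.
  by rewrite e eqxx in nvm.
by exists x, y; split; [exact: cls | exact: cls |].
Qed.

(** An even number of colours leaves no colour 0, so every class must carry a negative loop and no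
    positive one. *)
Lemma matching_complete (T : finType) (G : sgraph T) n (sg : T -> bool) (c : T -> nat) :
  (forall v, 0 < c v <= n) ->
  (forall i, 0 < i <= n -> exists x y,
     [/\ sedge G x y = Some (~~ (sg x (+) sg y)), c x = i & c y = i]) ->
  (forall x y, c x = c y -> sedge G x y <> Some (sg x (+) sg y)) ->
  (forall i j s, 0 < i <= n -> 0 < j <= n -> i <> j -> exists x y,
     [/\ sedge G x y = Some (s (+) (sg x (+) sg y)), c x = i & c y = j]) ->
  has_complete G n.*2.
Proof.
move=> hc hl hp hcr; apply/has_completeP; exists sg, c.
have col i : (Posz i \in colours n.*2) = (0 < i <= n).
  by rewrite in_colours doubleK odd_double orbF andbC lt0n.
split=> [v|i|i j s]; rewrite ?col //.
  by case/hl=> x [y [_ h _]]; exists x.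
move=> hi hj; case: eqP => [<-|nij]; last by split=> // _; apply: hcr.
have i0 : i != 0 by case/andP: hi; rewrite lt0n.
rewrite i0 /=; split=> [[x [y [h1 h2 h3]]]|/eqP ->].
  case: s h1 => // h1; have := hp x y; rewrite h2 h3 => /(_ erefl).
  by rewrite h1; case: (sg x); case: (sg y).
by have [x [y h]] := hl i hi; exists x, y.
Qed.

(** * From satisfiability to complete colourings *)

(** The images of [g] are listed first, then the missing values; [f] looks up this list and [f']
    searches it. In the matching, this gives the fillers the right vertices that are left over. *)
Lemma partial_injection_extend (g : nat -> nat) n p :
  n <= p -> {in gtn n, forall a, g a < p} -> {in gtn n &, injective g} ->
  exists f f' : nat -> nat, [/\ {in gtn n, f =1 g},
    {in gtn p, forall a, f a < p /\ f' (f a) = a} &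
    {in gtn p, forall b, f' b < p /\ f (f' b) = b}].
Proof.
move=> hn hg ig.
pose r := [seq g a | a <- iota 0 n].
pose s := r ++ [seq b <- iota 0 p | b \notin r].
have ur : uniq r.
  rewrite map_inj_in_uniq ?iota_uniq // => a b; rewrite !mem_iota /= !add0n.
  by move=> ha hb; apply: ig.
have us : uniq s.
  rewrite cat_uniq ur filter_uniq ?iota_uniq // andbT /=.
  by apply/hasPn => b; rewrite mem_filter => /andP[].
have ms b : (b \in s) = (b < p).
  rewrite mem_cat mem_filter mem_iota /= add0n.
  case: (boolP (b \in r)) => //= /mapP[a]; rewrite mem_iota /= add0n => ha ->.
  by rewrite hg.
have ss : size s = p.
  rewrite -(size_iota 0 p); apply/eqP; rewrite -uniq_size_uniq ?iota_uniq //.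
  by move=> b; rewrite mem_iota ms.
exists (nth 0 s), (index^~ s); split.
- move=> a; rewrite inE /= => ha; rewrite nth_cat size_map size_iota ha.
  by rewrite (nth_map 0) ?size_iota // nth_iota.
- move=> a; rewrite inE /= => ha; rewrite -ms mem_nth ?ss //; split=> //.
  by rewrite index_uniq ?ss.
- move=> b; rewrite inE /= => hb; rewrite -{1}ss index_mem ms; split=> //.
  by rewrite nth_index // ms.
Qed.

(** * The signed graph of a formula *)

Section Gadget.
Variables (m V : nat) (lit : nat -> nat -> bool -> bool).

(** A CNF formula with [m] clauses and [V] variables is given by [lit]: clause [c] is made true by
    value [b] of variable [v] when [lit c v b]. *)
Definition satisfiable : Prop := exists val : nat -> bool,
  forall c, c < m -> exists2 v, v < V & lit c v (val v).

(* The literal [(v, b)] has index [2 v + b]. *)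
Definition lit_at (c l : nat) : bool := lit c l./2 (odd l).

Definition side : nat := m.+1 * V.*2.

(* Left vertices: clause [c] is [c], variable [v] is [m + v], the others are
   fillers. Right vertex [c * 2V + l] stands for literal [l] of clause [c], or
   for the truth value [l] of its variable when [c = m]. *)
Definition pos_pair (a b : nat) : bool :=
  if a < m then (b %/ V.*2 == a) && lit_at a (b %% V.*2)
  else if a < m + V then (b %/ V.*2 == m) && ((b %% V.*2)./2 == a - m)
  else true.

(** A clause sees the truth values that satisfy it; a variable sees the clause literals of other
    variables. If a clause is matched with a literal of [v], both kinds of edge are thus missing
    towards a variable only when it is [v] and its value does not satisfy the clause. *)
Definition neg_pair (a b : nat) : bool :=
  if a < m then (b %/ V.*2 == m) && lit_at a (b %% V.*2)
  else if a < m + V then (b %/ V.*2 < m) && ((b %% V.*2)./2 != a - m)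
  else false.

(** Meant for [u < v]. The right side runs from [side] to [side.*2 - 1]; vertex [side.*2] is the
    apex and [side.*2.+1] the pendant vertex. *)
Definition adj_lt (u v : nat) : bool :=
  if v == side.*2.+1 then u == side.*2
  else if v == side.*2 then true
  else if side <= v then
    [|| side <= u, pos_pair u (v - side) | neg_pair u (v - side)]
  else ~~ [&& u < m, m <= v & v < m + V].

Definition sgn_lt (u v : nat) : bool :=
  [&& side <= v, v < side.*2 & (side <= u) || ~~ pos_pair u (v - side)].

Definition gadj (u v : nat) : bool :=
  if u < v then adj_lt u v else (v < u) && adj_lt v u.

Definition gsgn (u v : nat) : bool := if u < v then sgn_lt u v else sgn_lt v u.

Definition gsedge (u v : nat) : option sign :=
  if gadj u v then Some (gsgn u v) else None.

Lemma gsedge_sym u v : gsedge u v = gsedge v u.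
Proof. by rewrite /gsedge /gadj /gsgn; case: ltngtP => // ->. Qed.

Lemma gsedge_irr u : gsedge u u = None.
Proof. by rewrite /gsedge /gadj ltnn. Qed.

Definition gorder : nat := side.*2.+2.

Definition gadget : sgraph 'I_gorder :=
  @SGraph 'I_gorder (fun u v => gsedge u v) (fun u v => gsedge_sym u v)
    (fun u => gsedge_irr u).

Hypothesis V0 : 0 < V.

(** Leaves room for all clauses and variables on the left side. *)
Lemma side_ge : m + V <= side.
Proof. by rewrite /side -muln2; nia. Qed.

Lemma gsedge_top u : u < side.*2.+1 ->
  gsedge side.*2.+1 u = if u == side.*2 then Some pos else None.
Proof.
move=> hu; rewrite gsedge_sym /gsedge /gadj /gsgn hu /adj_lt eqxx /sgn_lt.
by case: eqP => // _; congr Some; rewrite /pos; apply/negbTE; lia.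
Qed.

Lemma gsedge_apex u : u < side.*2 -> gsedge side.*2 u = Some pos.
Proof.
move=> hu; rewrite gsedge_sym /gsedge /gadj /gsgn hu /adj_lt eqxx /sgn_lt.
rewrite ltn_eqF // ltnn andbF //.
Qed.

Lemma gsedge_right u v : side <= u < side.*2 -> side <= v < side.*2 -> u != v ->
  gsedge u v = Some neg.
Proof.
move=> /andP[hu1 hu2] /andP[hv1 hv2] nuv.
wlog huv : u v hu1 hu2 hv1 hv2 nuv / u < v.
  move=> H; case: (ltngtP u v) nuv => // h _; first by apply: H => //; rewrite neq_ltn h.
  by rewrite gsedge_sym; apply: H => //; rewrite neq_ltn h.
rewrite /gsedge /gadj /gsgn huv /adj_lt /sgn_lt hv1 hv2 hu1 /=.
have -> : (v == side.*2.+1) = false by lia.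
by have -> : (v == side.*2) = false by lia.
Qed.

Lemma gsedge_cross a b : a < side -> b < side -> gsedge a (side + b) =
  if pos_pair a b then Some pos else if neg_pair a b then Some neg else None.
Proof.
move=> ha hb; rewrite /gsedge /gadj /gsgn.
have -> : a < side + b by lia.
rewrite /adj_lt /sgn_lt leq_addr addKn -addnn ltn_add2l hb leqNgt ha /=.
have -> : (side + b == (side + side).+1) = false by lia.
have -> : (side + b == side + side) = false by lia.
by case: (pos_pair a b); case: (neg_pair a b).
Qed.

Lemma gsedge_left a a' : a < side -> a' < side -> a != a' -> gsedge a a' =
  if [&& a < m, m <= a' & a' < m + V] || [&& a' < m, m <= a & a < m + V]
  then None else Some pos.
Proof.
move=> ha ha' naa.
wlog h : a a' ha ha' naa / a < a'.
  move=> H; case: (ltngtP a a') naa => // h _; first by apply: H => //; rewrite neq_ltn h.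
  by rewrite gsedge_sym orbC; apply: H => //; rewrite neq_ltn h.
rewrite /gsedge /gadj /gsgn h /adj_lt /sgn_lt [side <= a']leqNgt ha' /=.
have -> : (a' == side.*2.+1) = false by lia.
have -> : (a' == side.*2) = false by lia.
have -> : [&& a' < m, m <= a & a < m + V] = false by lia.
by rewrite orbF if_neg.
Qed.

(** [k] is any number from the order on, so that the same lemma excludes an achromatic number above
    the order. *)
Lemma complete_gadget_sat k : gorder <= k -> has_complete gadget k ->
  k = gorder /\ satisfiable.
Proof.
move=> hk hG.
have := @complete_matching _ gadget k; rewrite card_ord => /(_ hk).
case=> [|//|-> [sg [mate [mK me mc]]]]; first by rewrite /gorder /= odd_double.
split=> //.
have mV := side_ge; have hgo : gorder = side.*2.+2 by [].
pose top : 'I_gorder := ord_max; pose apex : 'I_gorder := inord side.*2.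
have etop : top = side.*2.+1 :> nat by [].
have eapex : apex = side.*2 :> nat by rewrite inordK // /gorder.
have me' (v : 'I_gorder) : gsedge v (mate v) = Some (~~ (sg v (+) sg (mate v))) by exact: me.
have mtop : mate top = apex.
  have := me' top; rewrite etop; have [|h] := ltnP (mate top) side.*2.+1.
    move=> h; rewrite gsedge_top //; case: eqP => // e _.
    by apply: val_inj; rewrite /= e eapex.
  have -> : mate top = top by apply: val_inj => /=; have := ltn_ord (mate top); lia.
  by rewrite etop gsedge_irr.
have mapex : mate apex = top by rewrite -mtop mK.
have small (v : 'I_gorder) : v < side.*2 -> mate v < side.*2.
  move=> hv; have := ltn_ord (mate v).
  have [//|h1 h2] := ltnP (mate v) side.*2.
  have [e|e] : mate v = side.*2 :> nat \/ mate v = side.*2.+1 :> nat by lia.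
    have /(congr1 mate) : mate v = apex by apply: val_inj; rewrite /= e eapex.
    by rewrite mK mapex => e'; move: hv; rewrite e' etop; lia.
  have /(congr1 mate) : mate v = top by apply: val_inj; rewrite /= e.
  by rewrite mK mtop => e'; move: hv; rewrite e' eapex; lia.
(* Between the class of the pendant vertex and that of [v] all edges start at the apex and are
   positive, so both signs occur only if [sg] differs on [v] and its mate. *)
have msg (v : 'I_gorder) : v < side.*2 -> sg (mate v) = ~~ sg v.
  move=> hv; have hv' := small v hv.
  have H s : exists y, (y = v \/ y = mate v) /\ s = sg apex (+) sg y.
    have [|| x [y [hx hy]]] := mc top v s.
    - by apply/eqP => e; move: hv; rewrite e etop; lia.
    - by rewrite mtop; apply/eqP => e; move: hv; rewrite e eapex; lia.
    have yl : y < side.*2 by case: hy => ->.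
    rewrite mtop in hx; case: hx => -> /= h.
      by move: h; rewrite gsedge_top ?ltn_eqF //; lia.
    exists y; split=> //; move: h; rewrite eapex gsedge_apex // => -[].
    by case: (s); case: (sg apex); case: (sg y).
  have [y [hy ey]] := H true; have [z [hz ez]] := H false.
  by move: ey ez; case: hy => ->; case: hz => ->; case: (sg apex); case: (sg v);
    case: (sg (mate v)).
have mpos (v : 'I_gorder) : v < side.*2 -> gsedge v (mate v) = Some pos.
  by move=> hv; rewrite me' msg //; case: (sg v).
have mright (v : 'I_gorder) : side <= v < side.*2 -> mate v < side.
  move=> hv; have hv' := small v ltac:(lia); rewrite ltnNge; apply/negP => h.
  have := mpos v; rewrite gsedge_right //; [move=> H; have := H ltac:(lia); by [] |lia|].
  apply/eqP => e; have := mpos v ltac:(lia); rewrite -e gsedge_irr //.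
(* [mate] maps the right side injectively into the left one, which is not larger, hence onto it. *)
have mleft (v : 'I_gorder) : v < side -> side <= mate v < side.*2.
  pose A := [set v : 'I_gorder | v < side].
  pose B := [set v : 'I_gorder | side <= v < side.*2].
  have hAB : #|A| <= #|B|.
    pose sh (v : 'I_gorder) : 'I_gorder := inord (v + side).
    have hsh (v' : 'I_gorder) : v' < side -> sh v' = v' + side :> nat.
      by move=> h; rewrite inordK //; lia.
    rewrite -(@card_in_imset _ _ sh).
      apply: subset_leq_card; apply/subsetP => _ /imsetP[u hu ->].
      by move: hu; rewrite !inE => hu; rewrite hsh //; lia.
    move=> u w; rewrite !inE => hu hw /(congr1 val) /=; rewrite !hsh // => e.
    by apply: val_inj => /=; lia.
  have sBA : mate @: B \subset A.
    by apply/subsetP => _ /imsetP[u hu ->]; move: hu; rewrite !inE; apply: mright.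
  have /eqP eA : mate @: B == A.
    by rewrite eqEcard sBA card_imset //; apply: inv_inj.
  move=> hv; have : v \in A by rewrite inE.
  by rewrite -eA => /imsetP[u hu ->]; rewrite mK; move: hu; rewrite inE.
have mcross (a : 'I_gorder) : a < side -> pos_pair a (mate a - side).
  move=> ha; have h := mleft a ha; have := mpos a ltac:(lia).
  have e : mate a = side + (mate a - side) :> nat by lia.
  rewrite {1}e gsedge_cross //; last lia.
  by case: (pos_pair _ _) => //; case: (neg_pair _ _).
(* [bet (m + v)] is the literal matched with variable [v], within the block of truth values; its
   parity is the value of [v]. *)
pose bet (a : nat) := (mate (inord a) - side) %% V.*2.
exists (fun v => odd (bet (m + v))) => c hc.
pose C : 'I_gorder := inord c.
have eC : C = c :> nat by rewrite inordK // /gorder; lia.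
have hC := mleft C ltac:(lia).
have := mcross C ltac:(lia); rewrite /pos_pair eC hc => /andP[/eqP dC lC].
set l := (mate C - side) %% V.*2 in lC.
have hl : l < V.*2 by rewrite ltn_mod double_gt0.
pose v := l./2; have hv : v < V by rewrite /v; lia.
exists v => //.
pose X : 'I_gorder := inord (m + v).
have eX : X = m + v :> nat by rewrite inordK // /gorder; lia.
have hX := mleft X ltac:(lia).
have := mcross X ltac:(lia).
rewrite /pos_pair eX ltnNge leq_addr /= ltn_add2l hv addKn => /andP[/eqP dX /eqP lX].
(* As mates have opposite [sg], this choice asks for a positive edge inside a side or a negative
   edge across. The left ends are not adjacent and right edges are negative, so the edge goes
   across; from [X] to the literal of [C] it would need another variable than [v]. *)
have [|| x [y [hx hy]]] := mc C X (sg C (+) sg X).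
- by apply/eqP => /(congr1 val) /=; rewrite eC eX; lia.
- by apply/eqP => /(congr1 val) /=; rewrite eX; lia.
have eCm : mate C = side + (mate C - side) :> nat by lia.
have eXm : mate X = side + (mate X - side) :> nat by lia.
case: hx => ->; case: hy => -> /=.
- rewrite eC eX gsedge_left; [|lia..].
  by have -> : [&& c < m, m <= m + v & m + v < m + V] by lia.
- rewrite eXm eC gsedge_cross; [|lia..].
  rewrite /pos_pair /neg_pair hc dX eqxx /=.
  have -> : (m == c) = false by lia.
  by rewrite /= /lit_at lX /bet -/X; case: (lit _ _ _).
- rewrite gsedge_sym eCm eX gsedge_cross; [|lia..].
  rewrite /pos_pair /neg_pair ltnNge leq_addr /= ltn_add2l hv addKn dC.
  have -> : (c == m) = false by lia.
  by rewrite -/l -/v eqxx andbF.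
- rewrite gsedge_right ?msg //; try lia.
    by case: (sg C); case: (sg X).
  by apply/eqP => /val_inj /(inv_inj mK) /(congr1 val) /=; rewrite eC eX; lia.
Qed.

(** Each clause is matched with one of its true literals in its own block, each variable with its
    value in block [m], and the fillers with the rest. *)
Lemma sat_complete_gadget : satisfiable -> has_complete gadget gorder.
Proof.
case=> val hval; have mV := side_ge; have hgo : gorder = side.*2.+2 by [].
pose ch c := find (fun v => lit c v (val v)) (iota 0 V).
have hch c : c < m -> ch c < V /\ lit c (ch c) (val (ch c)).
  move=> /hval[v hv hl].
  have hh : has (fun v => lit c v (val v)) (iota 0 V).
    by apply/hasP; exists v; rewrite ?mem_iota.
  have h1 : ch c < V by have := hh; rewrite has_find size_iota.
  by split=> //; have := nth_find 0 hh; rewrite nth_iota.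
pose code v := v.*2 + val v.
have code_half v : (code v)./2 = v by rewrite /code; case: (val v); lia.
have code_odd v : odd (code v) = val v by rewrite /code oddD odd_double; case: (val v).
have code_lt v : v < V -> code v < V.*2 by rewrite /code; case: (val v); lia.
pose g a := if a < m then a * V.*2 + code (ch a) else m * V.*2 + code (a - m).
have gdiv a : a < m + V -> g a %/ V.*2 = minn a m.
  move=> ha; rewrite /g; case: ifP => h.
    by rewrite divnMDl ?double_gt0 // divn_small ?addn0 ?code_lt; [lia| |case: (hch a h)].
  by rewrite divnMDl ?double_gt0 // divn_small ?addn0 ?code_lt //; lia.
have gmod a : a < m + V -> g a %% V.*2 = code (if a < m then ch a else a - m).
  move=> ha; rewrite /g; case: ifP => h; rewrite modnMDl modn_small // code_lt //.
    by case: (hch a h).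
  by lia.
have g_lt a : a < m + V -> g a < side.
  move=> ha; rewrite /side -ltn_divLR ?double_gt0 // gdiv //; lia.
have g_inj : {in gtn (m + V) &, injective g}.
  move=> a b; rewrite !inE /= => ha hb e.
  have := gdiv a ha; rewrite e gdiv // => e1.
  have := gmod a ha; rewrite e gmod // => /(congr1 half); rewrite !code_half => e2.
  by move: e1 e2; case: ifP; case: ifP; lia.
have [f [f' [fg fK f'K]]] := partial_injection_extend mV g_lt g_inj.
have fpos a : a < side -> pos_pair a (f a).
  move=> ha; rewrite /pos_pair; case: ifP => h1.
    rewrite fg ?inE /=; last lia.
    rewrite gdiv ?gmod ?h1; [|lia..].
    have [_ hl] := hch a h1; rewrite /lit_at code_half code_odd hl.
    by apply/andP; split=> //; lia.
  case: ifP => // h2; rewrite fg ?inE //= gdiv // gmod // h1 code_half eqxx andbT; lia.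
(* The right side and the pendant vertex are switched, which turns the positive matched edges into
   negative ones. *)
pose sg (v : 'I_gorder) := (side <= v) && (v != side.*2 :> nat).
pose cl (v : nat) := if v < side then v.+1 else
  if v < side.*2 then (f' (v - side)).+1 else side.+1.
have f'lt b : b < side -> f' b < side by move=> hb; case: (f'K b hb).
have flt a : a < side -> f a < side by move=> ha; case: (fK a ha).
have inK u : u < gorder -> (inord u : 'I_gorder) = u :> nat by move=> h; rewrite inordK.
have clR a : a < side -> cl (side + f a) = a.+1.
  move=> ha; have hf := flt a ha; rewrite /cl ifF ?ifT ?addKn; [|lia..].
  by case: (fK a ha) => _ ->.
have sgL a : a < side -> sg (inord a) = false.
  by move=> ha; rewrite /sg inK //; lia.
have sgR a : a < side -> sg (inord (side + f a)) = true.
  by move=> ha; have := flt a ha => hf; rewrite /sg inK //; lia.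
change (has_complete gadget side.+1.*2).
apply: (@matching_complete _ gadget side.+1 sg (fun v => cl v)) => [v|i hi|x y|i j s hi hj nij].
- by rewrite /cl; case: ifP => h1; [lia|]; case: ifP => h2; have := f'lt (v - side); lia.
- have [h|->] : i <= side \/ i = side.+1 by lia.
    have ha : i.-1 < side by lia.
    have hf := flt _ ha.
    exists (inord i.-1), (inord (side + f i.-1)); split.
    + by rewrite sgL // sgR //= !inK; [rewrite gsedge_cross // fpos|lia..].
    + by rewrite inK /cl ?ha; lia.
    + by rewrite inK ?clR //; lia.
  exists (inord side.*2.+1), (inord side.*2); split.
  + rewrite /= /sg !inK; [|lia..]; rewrite gsedge_top // eqxx andbF.
    have -> : side <= side.*2.+1 by lia.
    by have -> : side.*2.+1 != side.*2 by lia.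
  + by rewrite inK /cl; [rewrite !ifF //; lia|lia].
  + by rewrite inK /cl; [rewrite !ifF //; lia|lia].
- move=> hxy /=.
  wlog lxy : x y hxy / x < y.
    move=> H; case: (ltngtP x y) => h; first exact: H.
      by rewrite gsedge_sym addbC; apply: H.
    by rewrite h gsedge_irr.
  have hx := ltn_ord x; have hy := ltn_ord y.
  have [hy1|hy1] := ltnP y side.
    by move: hxy; rewrite /cl hy1 (ltn_trans lxy hy1); lia.
  have [hy2|hy2] := ltnP y side.*2.
    have ey : y = side + (y - side) :> nat by lia.
    have [h1 h2] := f'K (y - side) ltac:(rewrite inE /=; lia).
    have [hx1|hx1] := ltnP x side; last first.
      move: hxy; rewrite /cl ifF; [|lia]; rewrite ifT; [|lia].
      rewrite ifF; [|lia]; rewrite ifT; [|lia].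
      move=> -[] /(congr1 f); rewrite h2.
      have [_ ->] := f'K (x - side) ltac:(rewrite inE /=; lia).
      lia.
    move: hxy; rewrite {1}/cl hx1 /cl ifF; [|lia]; rewrite hy2 => -[] ex.
    have -> : sg x = false by rewrite /sg leqNgt hx1.
    have -> : sg y = true by rewrite /sg hy1; lia.
    rewrite ey gsedge_cross; [|lia..].
    by have -> : pos_pair x (y - side) by rewrite -h2 -ex; apply: fpos.
  have [ex|ex] := eqVneq (x : nat) side.*2; last first.
    move: hxy; rewrite /cl; case: ifP => h1; [|case: ifP => h2]; rewrite !ifF; try lia.
    by have := f'lt (x - side); lia.
  have ey : y = side.*2.+1 :> nat by lia.
  have -> : sg x = false by rewrite /sg ex eqxx andbF.
  have -> : sg y = true by rewrite /sg ey; lia.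
  by rewrite gsedge_sym ey gsedge_top ?ex // eqxx.
wlog hij : i j hi hj nij / i < j.
  move=> H; case: (ltngtP i j) => h; [exact: H| |by case: nij].
  have [x [y [h1 h2 h3]]] := H j i hj hi (nesym nij) h.
  by exists y, x; split=> //; rewrite sedge_sym h1 [sg x (+) _]addbC.
have ha : i.-1 < side by lia.
have hf := flt _ ha; have cla : cl i.-1 = i by rewrite /cl ha; lia.
set a := i.-1 in ha hf cla *.
have clb : cl (side + f a) = i by rewrite clR // /a; lia.
have hj2 : j <= side \/ j = side.+1 by lia.
case: hj2 => [hjm|jm]; last first.
  (* The apex is not switched: its edge to a right vertex becomes negative, its edge to a left
     vertex stays positive. *)
  have sapex : sg (inord side.*2) = false by rewrite /sg inK ?eqxx ?andbF.
  have capex : cl side.*2 = side.+1 by rewrite /cl !ifF //; lia.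
  case: s.
    exists (inord (side + f a)), (inord side.*2).
    rewrite sgR // sapex /= !inK ?capex ?clb; [|lia..].
    by rewrite gsedge_sym gsedge_apex ?jm //; lia.
  exists (inord a), (inord side.*2).
  rewrite sgL // sapex /= !inK ?capex ?cla; [|lia..].
  by rewrite gsedge_sym gsedge_apex ?jm //; lia.
have ha' : j.-1 < side by lia.
have hf' := flt _ ha'; have cla' : cl j.-1 = j by rewrite /cl ha'; lia.
have naa : a != j.-1 by rewrite /a; lia.
have laa : a < j.-1 by rewrite /a; lia.
set a' := j.-1 in ha' hf' cla' naa laa *.
have clb' : cl (side + f a') = j by rewrite clR // /a'; lia.
(* Right vertices are all switched, so their edges stay negative; an edge of two left vertices gives
   the positive sign, unless they are a clause and a variable. *)
case: s.
  exists (inord (side + f a)), (inord (side + f a')).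
  rewrite !sgR // /= !inK ?clb ?clb'; [|lia..].
  rewrite gsedge_right //; [lia|lia|].
  rewrite eqn_add2l; apply/eqP => /(congr1 f').
  by case: (fK a ha) => _ ->; case: (fK a' ha') => _ ->; lia.
case haa : [&& a < m, m <= a' & a' < m + V]; last first.
  exists (inord a), (inord a').
  rewrite !sgL // /= !inK ?cla ?cla'; [|lia..].
  rewrite gsedge_left // haa /=.
  by have -> : [&& a' < m, m <= a & a < m + V] = false by lia.
have fa : f a = g a by rewrite fg // inE /=; lia.
have fa' : f a' = g a' by rewrite fg // inE /=; lia.
have da := gdiv a ltac:(lia); have da' := gdiv a' ltac:(lia).
have ma := gmod a ltac:(lia); have ma' := gmod a' ltac:(lia).
have [h1 h2] := hch a ltac:(lia).
have am : a < m by lia.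
have a'm : (a' < m) = false by lia.
rewrite am in ma; rewrite a'm in ma'.
(* If the clause chose this very variable, the value of the variable satisfies it and the edge from
   the clause to this value is negative. Otherwise the variable has a negative edge to the chosen
   literal. Switching makes either edge positive. *)
have [e|ne] := eqVneq (ch a) (a' - m).
  exists (inord a), (inord (side + f a')).
  rewrite sgL // sgR // /= !inK ?cla ?clb'; [|lia..].
  rewrite gsedge_cross // /pos_pair /neg_pair am fa' da' ma' /lit_at code_half code_odd.
  rewrite -e h2 andbT.
  have -> : (minn a' m == a) = false by lia.
  by have -> : (minn a' m == m) by lia.
exists (inord (side + f a)), (inord a').
rewrite sgR // sgL // /= !inK ?cla' ?clb; [|lia..].
rewrite gsedge_sym gsedge_cross // /pos_pair /neg_pair a'm fa da ma code_half ne.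
have -> : a' < m + V by lia.
have -> : (minn a m == m) = false by lia.
by have -> : minn a m < m by lia.
Qed.
End Gadget.

(** * Computations as satisfiability *)

(** For [j < 2|x| + 2] this is the part of [pair_code x u] before [u]: doubled bits, then the
    separator 01. *)
Definition code_bit (x : seq bool) (j : nat) : bool :=
  if j < (size x).*2 then nth false x j./2 else j != (size x).*2.

Lemma size_pair_code x u : size (pair_code x u) = (size x).*2.+2 + size u.
Proof.
elim: x => //= b x IH; rewrite -[LHS]/(size (pair_code x u)).+2 IH; lia.
Qed.

Lemma onth_pair_code x u j : onth (pair_code x u) j =
  if j < (size x).*2.+2 then Some (code_bit x j) else onth u (j - (size x).*2.+2).
Proof.
elim: x j => [|b x IH] j; first by case: j => [|[|j]] //=; rewrite subn2.
case: j => [|[|j]] //=; rewrite -[LHS]/(onth (pair_code x u) j) IH /code_bit /=.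
Qed.

Section CookLevin.
Variables (M : TM) (cert Bf : nat -> nat).

Let sym : finType := option (bool + tm_extra M).
Let tp : finType := 'I_(tm_tapes M).+1.
Let obs : finType := (tm_state M * {ffun tp -> sym})%type.

(** A halted machine rewrites what it reads and stays, so that one rule describes every step. *)
Definition act (o : obs) : tm_state M * {ffun tp -> sym * move} :=
  if tm_halt o.1 then (o.1, [ffun i => (o.2 i, Stay)]) else tm_delta o.1 o.2.

Definition observe (c : config M) : obs :=
  (cf_state c, [ffun i => cf_tape c i (cf_head c i)]).

Lemma tm_step_act c :
  [/\ cf_state (tm_step c) = (act (observe c)).1,
      forall i, cf_head (tm_step c) i = move_head ((act (observe c)).2 i).2 (cf_head c i) &
      forall i j, cf_tape (tm_step c) i j =
        if j == cf_head c i then ((act (observe c)).2 i).1 else cf_tape c i j].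
Proof.
rewrite /tm_step /act /=; case: ifP => h.
  split=> // [i|i j]; rewrite !ffunE //=.
  by case: eqP => [->|].
by case: (tm_delta _ _).
Qed.

(* A fact is a kind together with a time and a position. *)
Let kind : finType := (tm_state M + tp + tp * sym + tp * sym + obs)%type.
(** State, head and cell facts describe a configuration. [KRd] and [KOb] are intermediate facts
    about the symbols read; thanks to them no clause refers to the positions of all heads at
    once. *)
Definition KSt (q : tm_state M) : kind := inl (inl (inl (inl q))).
Definition KHd (i : tp) : kind := inl (inl (inl (inr i))).
Definition KCl (i : tp) (a : sym) : kind := inl (inl (inr (i, a))).
Definition KRd (i : tp) (a : sym) : kind := inl (inr (i, a)).
Definition KOb (o : obs) : kind := inr o.

Let NK := #|{: kind}|.

(* Clause schemas; a schema ignores the parameters it does not need. *)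
Let name : finType := ('I_14 * tp * sym * obs)%type.
Let NN := #|{: name}|.

Section Formula.
Variable x : seq bool.
Let B := Bf (size x).
Let nB := (size x).*2.+2.

Definition fact (k : kind) (t j : nat) : nat := (t * B + j) * NK + enum_rank k.

(** [nB] is the first certificate cell. The bounds on [t] and [j] keep the derived facts within
    times and positions below [B]. *)
Definition guard (nm : name) (t j j' : nat) : bool :=
  let: (r, i, a, o) := nm in
  match (r : nat) with
  | 2 => i != ord0
  | 3 => if a is Some (inl b) then (j < nB) && (b == code_bit x j) else false
  | 4 => (nB <= j) && (j < nB + cert (size x))
  | 5 => (nB <= j) && (j.+1 < B)
  | 6 => nB + cert (size x) <= j
  | 9 | 11 => t.+1 < B
  | 10 => (t.+1 < B) && (j.+1 < B)
  | 12 => (t.+1 < B) && (j != j')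
  | 13 => a != Some (inl true)
  | _ => true
  end.

Definition plit k t j (v : nat) (b : bool) : bool := (b == true) && (v == fact k t j).
Definition nlit k t j (v : nat) (b : bool) : bool := (b == false) && (v == fact k t j).

(** Schemas 0 to 6 give the initial configuration, where 4 to 6 leave open at most [cert (size x)]
    certificate bits followed by blanks; 7 and 8 derive what is read, 9 to 12 the next
    configuration, and 13 forbids a final output other than [true]. *)
Definition clause (nm : name) (t j j' : nat) (v : nat) (b : bool) : bool :=
  let: (r, i, a, o) := nm in
  match (r : nat) with
  | 0 => plit (KSt (tm_start M)) 0 0 v b
  | 1 => plit (KHd i) 0 0 v b
  | 2 => plit (KCl i None) 0 j v b
  | 3 => plit (KCl ord0 a) 0 j v b
  | 4 => [|| plit (KCl ord0 (Some (inl true))) 0 j v b,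
             plit (KCl ord0 (Some (inl false))) 0 j v b | plit (KCl ord0 None) 0 j v b]
  | 5 => nlit (KCl ord0 None) 0 j v b || plit (KCl ord0 None) 0 j.+1 v b
  | 6 => plit (KCl ord0 None) 0 j v b
  | 7 => [|| nlit (KHd i) t j v b, nlit (KCl i a) t j v b | plit (KRd i a) t 0 v b]
  | 8 => [|| nlit (KSt o.1) t 0 v b, [exists i', nlit (KRd i' (o.2 i')) t 0 v b]
           | plit (KOb o) t 0 v b]
  | 9 => nlit (KOb o) t 0 v b || plit (KSt (act o).1) t.+1 0 v b
  | 10 => [|| nlit (KOb o) t 0 v b, nlit (KHd i) t j v b
            | plit (KHd i) t.+1 (move_head ((act o).2 i).2 j) v b]
  | 11 => [|| nlit (KOb o) t 0 v b, nlit (KHd i) t j v b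
            | plit (KCl i ((act o).2 i).1) t.+1 j v b]
  | 12 => [|| nlit (KHd i) t j v b, nlit (KCl i a) t j' v b | plit (KCl i a) t.+1 j' v b]
  | _ => nlit (KCl ord_max a) B.-1 0 v b
  end.

(** The clause number is read in base [B] as name, [t], [j], [j']. An instance with a false guard
    becomes a tautology, containing both literals of variable 0. *)
Definition clause_at (c v : nat) (b : bool) : bool :=
  let t := c %/ B %/ B %% B in let j := c %/ B %% B in let j' := c %% B in
  [exists nm : name, (c %/ B %/ B %/ B == enum_rank nm) &&
     if guard nm t j j' then clause nm t j j' v b else v == 0].

Definition nclauses : nat := NN * (B * B * B).
Definition nvars : nat := B * B * NK.

Hypothesis hB : nB + cert (size x) < B.

Lemma NK_gt0 : 0 < NK.
Proof. by apply/card_gt0P; exists (KSt (tm_start M)). Qed.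

Lemma nvars_gt0 : 0 < nvars.
Proof. by rewrite /nvars !muln_gt0 NK_gt0; lia. Qed.

Lemma fact_lt k t j : t < B -> j < B -> fact k t j < nvars.
Proof.
move=> ht hj; rewrite /fact /nvars; have := ltn_ord (enum_rank k).
rewrite -/NK; set r := nat_of_ord _ => hr.
have : (t * B + j).+1 * NK <= B * B * NK by rewrite leq_mul2r; apply/orP; right; nia.
by rewrite mulSn; lia.
Qed.

Lemma satisfiable_clauses : satisfiable nclauses nvars clause_at <->
  exists val : nat -> bool, forall nm t j j', t < B -> j < B -> j' < B ->
    guard nm t j j' -> exists2 v, v < nvars & clause nm t j j' v (val v).
Proof.
have B0 : 0 < B by lia.
split=> [[val h]|[val h]]; exists val.
  move=> nm t j j' ht hj hj' hg.
  pose c := ((enum_rank nm * B + t) * B + j) * B + j'.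
  have c1 : c %/ B = (enum_rank nm * B + t) * B + j.
    by rewrite /c divnMDl // divn_small // addn0.
  have c2 : c %/ B %/ B = enum_rank nm * B + t by rewrite c1 divnMDl // divn_small // addn0.
  have c3 : c %/ B %/ B %/ B = enum_rank nm by rewrite c2 divnMDl // divn_small // addn0.
  have hc : c < nclauses.
    by rewrite /nclauses mulnA -ltn_divLR // mulnA -ltn_divLR // -ltn_divLR // c3 ltn_ord.
  have [v hv] := h c hc; rewrite /clause_at c3 c2 c1 => /existsP[nm' /andP[/eqP e]].
  have <- : nm = nm' by apply/enum_rank_inj/val_inj.
  rewrite !modnMDl !modn_small //.
  by rewrite hg => hcl; exists v.
move=> c hc.
have hr : c %/ B %/ B %/ B < NN.
  by rewrite !ltn_divLR // -!mulnA; move: hc; rewrite /nclauses !mulnA.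
pose nm : name := enum_val (Ordinal hr).
have en : enum_rank nm = c %/ B %/ B %/ B :> nat by rewrite enum_valK.
set t := c %/ B %/ B %% B; set j := c %/ B %% B; set j' := c %% B.
case hg : (guard nm t j j').
  have [||| v hv hcl] := h nm t j j' _ _ _ hg; rewrite ?ltn_mod //.
  by exists v => //; apply/existsP; exists nm; rewrite en eqxx -/t -/j -/j' hg.
exists 0; first exact: nvars_gt0.
by apply/existsP; exists nm; rewrite en eqxx -/t -/j -/j' hg.
Qed.

Definition run (u : seq bool) (t : nat) : config M :=
  iter t (@tm_step M) (init_config M (pair_code x u)).

(** Heads therefore stay on numbered cells at all times below [B]. *)
Lemma run_head_le u t i : cf_head (run u t) i <= t.
Proof.
elim: t => // t IH; rewrite [run u t.+1]iterS -/(run u t).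
have [_ -> _] := tm_step_act (run u t).
by case: (_ .2) => /=; lia.
Qed.

Definition holds (u : seq bool) (k : kind) (t j : nat) : bool :=
  match k with
  | inl (inl (inl (inl q))) => cf_state (run u t) == q
  | inl (inl (inl (inr i))) => cf_head (run u t) i == j
  | inl (inl (inr (i, a))) => (cf_tape (run u t) i j : sym) == a
  | inl (inr (i, a)) => (observe (run u t)).2 i == a
  | inr o => observe (run u t) == o
  end.

Lemma accepting_sat u : size u <= cert (size x) ->
  cf_tape (run u B.-1) ord_max 0 = Some (inl true) ->
  satisfiable nclauses nvars clause_at.
Proof.
move=> hu hacc; apply/satisfiable_clauses.
(* A variable is decoded into kind, time and position, and valued by the actual run. *)
pose val v := [exists k : kind, (enum_rank k == v %% NK :> nat) &&
  holds u k (v %/ NK %/ B) (v %/ NK %% B)].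
exists val.
have hval k t j : j < B -> val (fact k t j) = holds u k t j.
  move=> hj; have hk := ltn_ord (enum_rank k).
  have h1 : fact k t j %% NK = enum_rank k by rewrite /fact modnMDl modn_small.
  have h2 : fact k t j %/ NK = t * B + j.
    by rewrite /fact divnMDl ?NK_gt0 // divn_small // addn0.
  have h3 : (t * B + j) %/ B = t by rewrite divnMDl ?divn_small ?addn0 //; lia.
  have h4 : (t * B + j) %% B = j by rewrite modnMDl modn_small.
  apply/existsP/idP => [[k' /andP[/eqP e]]|h].
    have <- : k = k' by apply/enum_rank_inj/val_inj; rewrite /= e.
    by rewrite h2 h3 h4.
  by exists k; rewrite h1 eqxx h2 h3 h4.
(* A clause holds once it contains a true fact positively or, for [satN], a false fact
   negatively. *)
have satP k t j nm t0 j0 j0' : t < B -> j < B -> holds u k t j ->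
    (forall v b, plit k t j v b -> clause nm t0 j0 j0' v b) ->
    exists2 v, v < nvars & clause nm t0 j0 j0' v (val v).
  move=> ht hj hh hc; exists (fact k t j); first exact: fact_lt.
  by apply: hc; rewrite /plit hval // hh !eqxx.
have satN k t j nm t0 j0 j0' : t < B -> j < B -> ~~ holds u k t j ->
    (forall v b, nlit k t j v b -> clause nm t0 j0 j0' v b) ->
    exists2 v, v < nvars & clause nm t0 j0 j0' v (val v).
  move=> ht hj /negbTE hh hc; exists (fact k t j); first exact: fact_lt.
  by apply: hc; rewrite /nlit hval // hh !eqxx.
have B0 : 0 < B by lia.
have B1 : B.-1 < B by lia.
have cell0 j : cf_tape (run u 0) ord0 j = bit_cells M (pair_code x u) j by [].
have cellN j : nB + size u <= j -> cf_tape (run u 0) ord0 j = None.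
  by move=> hj; rewrite cell0 /bit_cells onth_default // size_pair_code.
have stepE t := tm_step_act (run u t).
have runS t : run u t.+1 = tm_step (run u t) by [].
move=> [[[[r hr] i] a] o] t j j' ht hj hj'.
do 14 try (case: r hr => [|r] hr); rewrite [guard _ _ _ _]/=.
- by move=> _; apply: (satP (KSt (tm_start M)) 0 0) => //=; apply/eqP.
- by move=> _; apply: (satP (KHd i) 0 0) => //=; apply/eqP.
- by move=> hi; apply: (satP (KCl i None) 0 j) => //=; rewrite /run /= (negbTE hi).
- case: a => [[b|]|] // /andP[h1 /eqP ->].
  apply: (satP (KCl ord0 (Some (inl (code_bit x j)))) 0 j) => //=.
  by rewrite ?cell0 /bit_cells onth_pair_code -/nB h1.
- case/andP=> h1 h2.
  case h: (cf_tape (run u 0) ord0 j) => [[[]|e]|].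
  + apply: (satP (KCl ord0 (Some (inl true))) 0 j) => //=; first exact/eqP.
    by move=> v b ->.
  + apply: (satP (KCl ord0 (Some (inl false))) 0 j) => //=; first exact/eqP.
    by move=> v b ->; rewrite orbT.
  + by move: h; rewrite cell0 /bit_cells; case: (onth _ _).
  + apply: (satP (KCl ord0 None) 0 j) => //=; first exact/eqP.
    by move=> v b ->; rewrite !orbT.
- case/andP=> h1 h2.
  case h: (holds u (KCl ord0 None) 0 j); last first.
    by apply: (satN (KCl ord0 None) 0 j) => //; [rewrite h | move=> v b /= ->].
  apply: (satP (KCl ord0 None) 0 j.+1) => //=; last by move=> v b ->; rewrite orbT.
  move: h => /= /eqP; rewrite ?cell0 /bit_cells => h.
  rewrite ?cell0 /bit_cells onth_default // leqW // leqNgt -onthTE.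
  by case: (onth _ _) h.
- move=> h; apply: (satP (KCl ord0 None) 0 j) => //=.
  by rewrite -?cell0 cellN // (leq_trans _ h) // leq_add2l.
- move=> _; case h1: (holds u (KHd i) t j); last first.
    by apply: (satN (KHd i) t j) => //; [rewrite h1 | move=> v b /= ->].
  case h2: (holds u (KCl i a) t j); last first.
    by apply: (satN (KCl i a) t j) => //; [rewrite h2 | move=> v b /= ->; rewrite orbT].
  apply: (satP (KRd i a) t 0) => //=; last by move=> v b ->; rewrite !orbT.
  by rewrite ffunE; move: h1 h2 => /= /eqP -> /eqP ->.
- move=> _; case h1: (holds u (KSt o.1) t 0); last first.
    by apply: (satN (KSt o.1) t 0) => //; [rewrite h1 | move=> v b /= ->].
  case h2: [forall i', holds u (KRd i' (o.2 i')) t 0]; last first.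
    move/negbT: h2; rewrite negb_forall => /existsP[i' hi'].
    apply: (satN (KRd i' (o.2 i')) t 0) => //=.
    move=> v b h; apply/orP; right; apply/orP; left; apply/existsP; by exists i'.
  apply: (satP (KOb o) t 0) => //=; last by move=> v b ->; rewrite !orbT.
  move: h1 => /= /eqP h1; apply/eqP; rewrite [RHS]surjective_pairing.
  rewrite /observe h1; congr pair; apply/ffunP => i'.
  by move/forallP: h2 => /(_ i') /= /eqP.
- move=> h; case h1: (holds u (KOb o) t 0); last first.
    by apply: (satN (KOb o) t 0) => //; [rewrite h1 | move=> v b /= ->].
  apply: (satP (KSt (act o).1) t.+1 0) => //=; last by move=> v b ->; rewrite !orbT.
  by move: h1 => /= /eqP <-; have [-> _ _] := stepE t.
- case/andP=> h h'; case h1: (holds u (KOb o) t 0); last first.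
    by apply: (satN (KOb o) t 0) => //; [rewrite h1 | move=> v b /= ->].
  case h2: (holds u (KHd i) t j); last first.
    by apply: (satN (KHd i) t j) => //; [rewrite h2 | move=> v b /= ->; rewrite orbT].
  apply: (satP (KHd i) t.+1 (move_head ((act o).2 i).2 j)) => //=.
  + by case: (_ .2) => /=; lia.
  + move: h1 h2 => /= /eqP <- /eqP <-; have [_ hh _] := stepE t.
    by rewrite hh.
  + by move=> v b ->; rewrite !orbT.
- move=> h; case h1: (holds u (KOb o) t 0); last first.
    by apply: (satN (KOb o) t 0) => //; [rewrite h1 | move=> v b /= ->].
  case h2: (holds u (KHd i) t j); last first.
    by apply: (satN (KHd i) t j) => //; [rewrite h2 | move=> v b /= ->; rewrite orbT].
  apply: (satP (KCl i ((act o).2 i).1) t.+1 j) => //=.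
  + move: h1 h2 => /= /eqP <- /eqP <-; have [_ _ hh] := stepE t.
    by rewrite hh eqxx.
  + by move=> v b ->; rewrite !orbT.
- case/andP=> h hjj; case h1: (holds u (KHd i) t j); last first.
    by apply: (satN (KHd i) t j) => //; [rewrite h1 | move=> v b /= ->].
  case h2: (holds u (KCl i a) t j'); last first.
    by apply: (satN (KCl i a) t j') => //; [rewrite h2 | move=> v b /= ->; rewrite orbT].
  apply: (satP (KCl i a) t.+1 j') => //=.
  + move: h1 h2 => /= /eqP e1 /eqP <-; have [_ _ hh] := stepE t.
    by rewrite hh e1 [j' == j]eq_sym (negbTE hjj).
  + by move=> v b ->; rewrite !orbT.
- move=> h; apply: (satN (KCl ord_max a) B.-1 0) => //=.
  by rewrite hacc eq_sym.
- by [].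
Qed.

(** A certificate is read off the valuation; the facts of its run are then forced true by induction
    on time. *)
Lemma sat_accepting : satisfiable nclauses nvars clause_at ->
  exists2 u, size u <= cert (size x) &
    cf_tape (run u B.-1) ord_max 0 = Some (inl true).
Proof.
case/satisfiable_clauses=> val h.
have B0 : 0 < B by lia.
pose F k t j := val (fact k t j).
have hP k t j v : plit k t j v (val v) -> F k t j by rewrite /plit /F => /andP[/eqP e /eqP <-].
have hN k t j v : nlit k t j v (val v) -> F k t j = false.
  by rewrite /nlit /F => /andP[/eqP e /eqP <-].
pose o0 : obs := (tm_start M, [ffun=> None]).
pose nm r (hr : r < 14) i a o : name := (Ordinal hr, i, a, o).
have f0 : F (KSt (tm_start M)) 0 0.
  have [|v _] := h (@nm 0 isT ord0 None o0) 0 0 0 B0 B0 B0; first by [].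
  exact: hP.
have f1 i : F (KHd i) 0 0.
  have [|v _] := h (@nm 1 isT i None o0) 0 0 0 B0 B0 B0; first by [].
  exact: hP.
have f2 i j : i != ord0 -> j < B -> F (KCl i None) 0 j.
  move=> hi hj; have [|v _] := h (@nm 2 isT i None o0) 0 j 0 B0 hj B0; first by [].
  exact: hP.
have f3 j : j < nB -> F (KCl ord0 (Some (inl (code_bit x j)))) 0 j.
  move=> hj; have hj' : j < B by lia.
  have [|v _] := h (@nm 3 isT ord0 (Some (inl (code_bit x j))) o0) 0 j 0 B0 hj' B0.
    by rewrite /= hj eqxx.
  exact: hP.
have f4 j : nB <= j < nB + cert (size x) ->
    [|| F (KCl ord0 (Some (inl true))) 0 j, F (KCl ord0 (Some (inl false))) 0 j
      | F (KCl ord0 None) 0 j].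
  move=> hj; have hj' : j < B by lia.
  have [|v _] := h (@nm 4 isT ord0 None o0) 0 j 0 B0 hj' B0; first by [].
  by case/or3P=> /hP ->; rewrite ?orbT.
have f5 j : nB <= j -> j.+1 < B -> F (KCl ord0 None) 0 j -> F (KCl ord0 None) 0 j.+1.
  move=> hj hj' hF.
  have [|v _] := h (@nm 5 isT ord0 None o0) 0 j 0 B0 (ltnW hj') B0.
    by rewrite /= hj hj'.
  by case/orP=> [/hN|/hP //]; rewrite hF.
have f6 j : nB + cert (size x) <= j -> j < B -> F (KCl ord0 None) 0 j.
  move=> hj hj'; have [|v _] := h (@nm 6 isT ord0 None o0) 0 j 0 B0 hj' B0; first by [].
  exact: hP.
have f7 i a t j : t < B -> j < B -> F (KHd i) t j -> F (KCl i a) t j -> F (KRd i a) t 0.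
  move=> ht hj h1 h2; have [|v _] := h (@nm 7 isT i a o0) t j 0 ht hj B0; first by [].
  by case/or3P=> [/hN|/hN|/hP //]; rewrite ?h1 ?h2.
have f8 (o : obs) t : t < B -> F (KSt o.1) t 0 -> (forall i, F (KRd i (o.2 i)) t 0) -> F (KOb o) t 0.
  move=> ht h1 h2; have [|v _] := h (@nm 8 isT ord0 None o) t 0 0 ht B0 B0; first by [].
  by case/or3P=> [/hN|/existsP[i /hN]|/hP //]; rewrite ?h1 ?h2.
have f9 (o : obs) t : t.+1 < B -> F (KOb o) t 0 -> F (KSt (act o).1) t.+1 0.
  move=> ht h1; have [|v _] := h (@nm 9 isT ord0 None o) t 0 0 (ltnW ht) B0 B0; first by [].
  by case/orP=> [/hN|/hP //]; rewrite ?h1.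
have f10 (o : obs) i t j : t.+1 < B -> j.+1 < B -> F (KOb o) t 0 -> F (KHd i) t j ->
    F (KHd i) t.+1 (move_head ((act o).2 i).2 j).
  move=> ht hj h1 h2.
  have [|v _] := h (@nm 10 isT i None o) t j 0 (ltnW ht) (ltnW hj) B0.
    by rewrite /= ht hj.
  by case/or3P=> [/hN|/hN|/hP //]; rewrite ?h1 ?h2.
have f11 (o : obs) i t j : t.+1 < B -> j < B -> F (KOb o) t 0 -> F (KHd i) t j ->
    F (KCl i ((act o).2 i).1) t.+1 j.
  move=> ht hj h1 h2.
  have [|v _] := h (@nm 11 isT i None o) t j 0 (ltnW ht) hj B0; first by [].
  by case/or3P=> [/hN|/hN|/hP //]; rewrite ?h1 ?h2.
have f12 i a t j j' : t.+1 < B -> j < B -> j' < B -> j != j' -> F (KHd i) t j ->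
    F (KCl i a) t j' -> F (KCl i a) t.+1 j'.
  move=> ht hj hj' njj h1 h2.
  have [|v _] := h (@nm 12 isT i a o0) t j j' (ltnW ht) hj hj'.
    by rewrite /= ht njj.
  by case/or3P=> [/hN|/hN|/hP //]; rewrite ?h1 ?h2.
have f13 (a : sym) : a != Some (inl true) -> F (KCl ord_max a) B.-1 0 = false.
  move=> ha; have [|v _] := h (@nm 13 isT ord0 a o0) 0 0 0 B0 B0 B0; first by [].
  exact: hN.
(* The certificate ends at the first cell without a bit fact. A cell with both bit facts counts as
   [true]: any choice among the true facts will do. *)
pose isb j := F (KCl ord0 (Some (inl true))) 0 (nB + j)
  || F (KCl ord0 (Some (inl false))) 0 (nB + j).
pose len := find (fun j => ~~ isb j) (iota 0 (cert (size x))).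
pose u := [seq F (KCl ord0 (Some (inl true))) 0 (nB + j) | j <- iota 0 len].
have hlen : len <= cert (size x) by rewrite -[X in _ <= X](size_iota 0); apply: find_size.
have su : size u = len by rewrite size_map size_iota.
have cell0 j : j < B -> F (KCl ord0 (bit_cells M (pair_code x u) j)) 0 j.
  move=> hj; rewrite /bit_cells onth_pair_code -/nB; case: ltnP => hn /=; first exact: f3.
  have [h1|h1] := ltnP (j - nB) len.
    have hb : isb (j - nB).
      have := before_find 0 h1; rewrite nth_iota ?add0n; last lia.
      by move/negbFE.
    have e : nB + (j - nB) = j by lia.
    have -> : onth u (j - nB) = Some (F (KCl ord0 (Some (inl true))) 0 j).
      by rewrite /u onth_map onthE (nth_map 0) ?size_iota // nth_iota // add0n /= e.
    move: hb; rewrite /isb e /=; case e1: (F _ 0 j) => //=.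
  rewrite onth_default ?su //=.
  have [hl|hl] : len = cert (size x) \/ len < cert (size x) by lia.
    by apply: f6 => //; lia.
  (* The first cell without a bit is blank by schema 4, and blanks propagate to the right by schema
     5. *)
  have hN0 : F (KCl ord0 None) 0 (nB + len).
    have nb : ~~ isb len.
      have hh : has (fun j => ~~ isb j) (iota 0 (cert (size x))).
        by rewrite has_find size_iota.
      by have := nth_find 0 hh; rewrite nth_iota.
    have := f4 (nB + len) ltac:(lia); move: nb; rewrite /isb.
    by case: (F _ _ _) => //=; case: (F _ _ _).
  suff H k : nB + len + k < B -> F (KCl ord0 None) 0 (nB + len + k).
    have e : nB + len + (j - nB - len) = j by lia.
    by have := H (j - nB - len); rewrite e; apply.
  elim: k => [|k IH] hk; first by rewrite addn0.
  by rewrite addnS; apply: f5; [lia|lia|apply: IH; lia].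
exists u; first by rewrite su.
have inv t : t < B -> [/\ F (KSt (cf_state (run u t))) t 0,
    forall i, F (KHd i) t (cf_head (run u t) i) &
    forall i j, j < B -> F (KCl i (cf_tape (run u t) i j)) t j].
  elim: t => [|t IH] ht.
    split=> // i j hj; have [->|ni] := eqVneq i ord0; first exact: cell0.
    by rewrite /run /= (negbTE ni); apply: f2.
  have [i1 i2 i3] := IH (ltnW ht).
  have hh i := run_head_le u t i.
  have [s1 s2 s3] := tm_step_act (run u t).
  have hO : F (KOb (observe (run u t))) t 0.
    apply: f8 => //; [lia|] => i; apply: (@f7 _ _ _ (cf_head (run u t) i)) => //.
    - lia.
    - by have := hh i; lia.
    - by rewrite ffunE; apply: i3; have := hh i; lia.
  rewrite [run u t.+1]iterS -/(run u t); split.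
  - by rewrite s1; apply: f9.
  - by move=> i; rewrite s2; apply: f10 => //; have := hh i; lia.
  - move=> i j hj; rewrite s3; case: eqP => [->|nj].
      by apply: f11 => //; have := hh i; lia.
    apply: (@f12 _ _ _ (cf_head (run u t) i)) => //.
    + by have := hh i; lia.
    + by apply/eqP => e; apply: nj.
    + exact: i3.
have [_ _ hc] := inv B.-1 ltac:(lia).
(* Any other symbol in the output cell would be a true fact that schema 13 makes false. *)
have := hc ord_max 0 B0; case: eqP (@f13 (cf_tape (run u B.-1) ord_max 0)) => // _.
by move=> /(_ isT) ->.
Qed.
End Formula.
End CookLevin.

(** * The reduction is computable in polynomial time *)

Section DefClause.
Variables (M : TM) (cert Bf : nat -> nat).
Hypotheses (hcert : is_poly cert) (hBf : is_poly Bf).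

Lemma def_fact k t j : def t -> def j -> def (fun x e => @fact M Bf x k (t x e) (j x e)).
Proof. by move=> ht hj; rewrite /fact; def_tac. Qed.

Lemma def_plit k t j v b : def t -> def j -> def v -> defb b ->
  defb (fun x e => @plit M Bf x k (t x e) (j x e) (v x e) (b x e)).
Proof.
move=> ht hj hv hb; rewrite /plit; apply: defb_and.
  exact: (defb_eqb hb (defb_cst true)).
exact: defb_eqn hv (def_fact _ ht hj).
Qed.

Lemma def_nlit k t j v b : def t -> def j -> def v -> defb b ->
  defb (fun x e => @nlit M Bf x k (t x e) (j x e) (v x e) (b x e)).
Proof.
move=> ht hj hv hb; rewrite /nlit; apply: defb_and.
  exact: (defb_eqb hb (defb_cst false)).
exact: defb_eqn hv (def_fact _ ht hj).
Qed.

Lemma def_guard nm t j j' : def t -> def j -> def j' ->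
  defb (fun x e => @guard M cert Bf x nm (t x e) (j x e) (j' x e)).
Proof.
move=> ht hj hj'; case: nm => [[[[r hr] i] a] o]; rewrite /guard /=.
do 14 try (case: r hr => [|r] hr); def_tac.
by case: a => [[b|a]|]; rewrite /code_bit; def_tac.
Qed.

Lemma def_clause nm t j j' v b : def t -> def j -> def j' -> def v -> defb b ->
  defb (fun x e => @clause M Bf x nm (t x e) (j x e) (j' x e) (v x e) (b x e)).
Proof.
move=> ht hj hj' hv hb; case: nm => [[[[r hr] i] a] o]; rewrite /clause /=.
do 14 try (case: r hr => [|r] hr);
  repeat first [ apply: defb_or | apply: def_plit => // | apply: def_nlit => //
               | apply: defb_exists => ? | def_step ].
by case: (_ .2); rewrite /move_head; def_tac.
Qed.

Lemma def_clause_at c v b : def c -> def v -> defb b ->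
  defb (fun x e => @clause_at M cert Bf x (c x e) (v x e) (b x e)).
Proof.
move=> hc hv hb; rewrite /clause_at; apply: defb_exists => nm.
have hB : def (fun x _ => Bf (size x)) by def_tac.
have ht : def (fun x e => c x e %/ Bf (size x) %/ Bf (size x) %% Bf (size x)) by def_tac.
have hj : def (fun x e => c x e %/ Bf (size x) %% Bf (size x)) by def_tac.
have hj' : def (fun x e => c x e %% Bf (size x)) by def_tac.
apply: defb_and; first by def_tac.
apply: defb_if; [exact: def_guard | exact: def_clause | by def_tac].
Qed.
End DefClause.

Section DefGadget.
Variables (m V : seq bool -> nat) (lit : seq bool -> nat -> nat -> bool -> bool).
Hypotheses (hm : def (fun x _ => m x)) (hV : def (fun x _ => V x)).
Hypothesis hl : forall c v b, def c -> def v -> defb b ->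
  defb (fun x e => lit x (c x e) (v x e) (b x e)).

Lemma def_side : def (fun x _ => side (m x) (V x)).
Proof. by rewrite /side; def_tac. Qed.

Lemma def_gorder : def (fun x _ => gorder (m x) (V x)).
Proof. by have h := def_side; rewrite /gorder; def_tac. Qed.

Lemma def_pos_pair a b : def a -> def b ->
  defb (fun x e => pos_pair (m x) (V x) (lit x) (a x e) (b x e)).
Proof.
move=> ha hb; rewrite /pos_pair /lit_at.
by repeat first [ def_step | apply: hl ].
Qed.

Lemma def_neg_pair a b : def a -> def b ->
  defb (fun x e => neg_pair (m x) (V x) (lit x) (a x e) (b x e)).
Proof.
move=> ha hb; rewrite /neg_pair /lit_at.
by repeat first [ def_step | apply: hl ].
Qed.

Lemma def_adj_lt u v : def u -> def v ->
  defb (fun x e => adj_lt (m x) (V x) (lit x) (u x e) (v x e)).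
Proof.
move=> hu hv; have hs := def_side; rewrite /adj_lt.
by repeat first [ apply: def_pos_pair | apply: def_neg_pair | def_step ].
Qed.

Lemma def_sgn_lt u v : def u -> def v ->
  defb (fun x e => sgn_lt (m x) (V x) (lit x) (u x e) (v x e)).
Proof.
move=> hu hv; have hs := def_side; rewrite /sgn_lt.
by repeat first [ apply: def_pos_pair | def_step ].
Qed.

Lemma def_gadj u v : def u -> def v ->
  defb (fun x e => gadj (m x) (V x) (lit x) (u x e) (v x e)).
Proof.
move=> hu hv; rewrite /gadj.
by repeat first [ apply: def_adj_lt | def_step ].
Qed.

Lemma def_gsgn u v : def u -> def v ->
  defb (fun x e => gsgn (m x) (V x) (lit x) (u x e) (v x e)).
Proof.
move=> hu hv; rewrite /gsgn.
by repeat first [ apply: def_sgn_lt | def_step ].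
Qed.
End DefGadget.

Lemma flatten_filter (T S : Type) (p : pred T) (F : T -> seq S) s :
  flatten [seq if p d then F d else [::] | d <- s]
  = flatten [seq F d | d <- s & p d].
Proof. by elim: s => //= d s ->; case: (p d). Qed.

Lemma flatten_flatten (T : Type) (s : seq (seq (seq T))) :
  flatten (flatten s) = flatten (map flatten s).
Proof. by elim: s => //= a s IH; rewrite flatten_cat IH. Qed.

Lemma map_enum_ord (T : Type) n (F : nat -> T) :
  [seq F i | i : 'I_n <- enum 'I_n] = [seq F i | i <- iota 0 n].
Proof. by rewrite -val_enum_ord -map_comp. Qed.

(* The binary digits of [k] are printed by a loop over the powers of two up to
   [k]: a loop over exponents would need values that are not polynomially
   bounded. *)
Definition pow2 (d : nat) : bool :=
  (0 < d) && (\sum_(e < d.+1) [&& odd e, 1 < e & e %| d] == 0).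

(** Writing [d = k * 2 ^ i] with [k] odd, the only possible obstruction is the odd divisor
    [k > 1]. *)
Lemma pow2P d : reflect (exists i, d = 2 ^ i) (pow2 d).
Proof.
apply: (iffP andP) => [[d0 /eqP h]|[i ->]].
  have [k k2 e] := pfactor_coprime (isT : prime 2) d0.
  exists (logn 2 d); rewrite [LHS]e; suff -> : k = 1 by rewrite mul1n.
  rewrite coprime2n in k2; case: (ltngtP k 1) => // hk; first by case: k hk k2 {e}.
  have kd : k %| d by rewrite e dvdn_mulr.
  have hk' : k < d.+1 by rewrite ltnS dvdn_leq.
  by have := h; rewrite (bigD1 (Ordinal hk')) //= k2 hk kd.
split; first by rewrite expn_gt0.
apply/eqP; apply: big1 => -[e he] _ /=; apply/eqP; rewrite eqb0.
apply/negP => /and3P[oe e1 /(dvdn_pfactor _ _ (isT : prime 2))[j _ ej]].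
by move: oe e1; rewrite ej; case: j {ej} => // j; rewrite oddX.
Qed.

(** Both lists are strictly increasing and have the same elements. *)
Lemma filter_pow2 k : 0 < k ->
  [seq d <- iota 0 k.+1 | pow2 d] = [seq 2 ^ i | i <- iota 0 (trunc_log 2 k).+1].
Proof.
move=> k0; apply: (irr_sorted_eq ltn_trans ltnn).
- by apply: sorted_filter; [exact: ltn_trans | exact: iota_ltn_sorted].
- rewrite sorted_map; apply: sub_sorted (iota_ltn_sorted 0 _) => i j /=.
  by rewrite ltn_exp2l.
move=> d; rewrite mem_filter mem_iota leq0n add0n ltnS andTb.
apply/andP/mapP => [[/pow2P[i ->] h]|[i]].
  by exists i => //; rewrite mem_iota /= add0n ltnS trunc_log_max.
rewrite mem_iota /= add0n ltnS => hi ->; split; first by apply/pow2P; exists i.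
by apply: leq_trans (trunc_logP (isT : 1 < 2) k0); rewrite leq_exp2l.
Qed.

Lemma def_pow2 a : def a -> defb (fun x e => pow2 (a x e)).
Proof.
move=> ha; rewrite /pow2; apply: defb_and; first by def_tac.
apply: defb_eqn (def_cst 0).
apply: (@def_sum (fun x e => (a x e).+1)
  (fun x e i => nat_of_bool [&& odd i, 1 < i & i %| a x e])); first by def_tac.
by rewrite /dvdn; def_tac.
Qed.

(** * Printing the instance *)

Section Output.
Variables (m V : seq bool -> nat) (lit : seq bool -> nat -> nat -> bool -> bool).
Hypotheses (hm : def (fun x _ => m x)) (hV : def (fun x _ => V x)).
Hypothesis hl : forall c v b, def c -> def v -> defb b ->
  defb (fun x e => lit x (c x e) (v x e) (b x e)).

Let K x := gorder (m x) (V x).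

Lemma polytime_instance :
  polytime (fun x => instance_code (gadget (m x) (V x) (lit x)) (K x)).
Proof.
have hK : def (fun x _ => K x) by exact: def_gorder.
pose A x (i j : nat) := gadj (m x) (V x) (lit x) i j.
pose S x (i j : nat) := gsgn (m x) (V x) (lit x) i j.
(* The digit of weight [d] is the parity of [K x %/ d], doubled as the pairing demands; then come
   the separator 01 and two bits per matrix entry. *)
have [c hc] : pdef (fun x _ =>
  flatten [seq if pow2 d then [:: odd (K x %/ d)] ++ [:: odd (K x %/ d)] else [::]
            | d <- iota 0 (K x).+1] ++ [:: false] ++ [:: true] ++
  flatten [seq flatten [seq [:: A x i j] ++ [:: A x i j && S x i j]
                         | j <- iota 0 (K x)] | i <- iota 0 (K x)]).
  apply: pdef_cat.
    apply: (@pdef_for (fun x _ => (K x).+1) (fun x _ d =>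
      if pow2 d then [:: odd (K x %/ d)] ++ [:: odd (K x %/ d)] else [::])).
      by def_tac.
    apply: pdef_if; first by apply: def_pow2; def_tac.
    by apply: pdef_cat; apply: pdef_bit; def_tac.
  apply: pdef_cat; first by apply: pdef_bit; def_tac.
  apply: pdef_cat; first by apply: pdef_bit; def_tac.
  apply: (@pdef_for (fun x _ => K x) (fun x _ i =>
    flatten [seq [:: A x i j] ++ [:: A x i j && S x i j] | j <- iota 0 (K x)])) => //.
  apply: (@pdef_for (fun x _ => K x) (fun x e j =>
    [:: A x (e 0) j] ++ [:: A x (e 0) j && S x (e 0) j])) => //.
  apply: pdef_cat; apply: pdef_bit; rewrite /A /S; last apply: defb_and.
  - by apply: def_gadj => //; def_tac.
  - by apply: def_gadj => //; def_tac.
  - by apply: def_gsgn => //; def_tac.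
have [M [p hp]] := polytime_peval c; exists M, p => x.
have := hp x; rewrite hc.
suff -> : instance_code (gadget (m x) (V x) (lit x)) (K x) =
  flatten [seq if pow2 d then [:: odd (K x %/ d)] ++ [:: odd (K x %/ d)] else [::]
            | d <- iota 0 (K x).+1] ++ [:: false] ++ [:: true] ++
  flatten [seq flatten [seq [:: A x i j] ++ [:: A x i j && S x i j]
                         | j <- iota 0 (K x)] | i <- iota 0 (K x)] by [].
rewrite /instance_code /pair_code flatten_filter filter_pow2 // -!map_comp.
congr (_ ++ [:: false, true & _]).
rewrite /sgraph_code flatten_flatten -map_comp -map_enum_ord.
congr flatten; apply: eq_map => i; rewrite -map_enum_ord.
congr flatten; apply: eq_map => j /=; rewrite /gsedge -/(A x i j) -/(S x i j).
by case: (A x i j).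
Qed.
End Output.

(** * Decoding instances *)

Lemma pair_code_inj x y x' y' :
  pair_code x y = pair_code x' y' -> x = x' /\ y = y'.
Proof.
elim: x x' => [|b x IH] [|b' x'] //=.
- by case.
- by case: b'.
- by case: b.
by case=> -> _ h; have [-> ->] := IH x' h.
Qed.

Definition nat_decode (s : seq bool) : nat := foldr (fun (b : bool) r => b + r.*2) 0 s.

Lemma nat_codeK : cancel nat_code nat_decode.
Proof.
move=> k; rewrite /nat_code; have := trunc_log_ltn k (isT : 1 < 2).
(* Generalised to any number [n] of digits with [k < 2 ^ n], for the induction. *)
move: (trunc_log 2 k).+1 => n; elim: n k => [|n IH] k hk.
  by move: hk; rewrite expn0; case: k.
rewrite /= divn1 -[1]addn0 iotaDl -map_comp.
rewrite (eq_map (_ : _ =1 fun i => odd (k./2 %/ 2 ^ i))).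
  rewrite -/(nat_decode _) IH ?odd_double_half //.
  by move: hk; rewrite expnS; lia.
by move=> i /=; rewrite add1n expnS divnMA divn2.
Qed.

Lemma size_flatten_const (T S : Type) (F : T -> seq S) n s :
  (forall i, size (F i) = n) -> size (flatten [seq F i | i <- s]) = size s * n.
Proof. by move=> h; elim: s => //= a s IH; rewrite size_cat h IH. Qed.

(** Blocks of equal lengths are cut off one at a time. *)
Lemma flatten_map_inj (T : eqType) (S : Type) (F F' : T -> seq S) s :
  (forall i, size (F i) = size (F' i)) ->
  flatten [seq F i | i <- s] = flatten [seq F' i | i <- s] ->
  {in s, F =1 F'}.
Proof.
move=> h; elim: s => //= a s IH e i; rewrite inE.
have e1 : F a = F' a.
  have := congr1 (take (size (F a))) e.
  by rewrite take_size_cat // (h a) take_size_cat.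
have e2 := congr1 (drop (size (F a))) e.
rewrite drop_size_cat // (h a) drop_size_cat // in e2.
by case/orP=> [/eqP ->|/IH -> //].
Qed.

Lemma size_edge_code e : size (edge_code e) = 2.
Proof. by case: e. Qed.

Lemma sgraph_codeE n (G : sgraph 'I_n) : sgraph_code G =
  flatten [seq flatten [seq edge_code (sedge G i j) | j <- enum 'I_n] | i <- enum 'I_n].
Proof. by rewrite /sgraph_code flatten_flatten -map_comp. Qed.

Lemma size_sgraph_code n (G : sgraph 'I_n) : size (sgraph_code G) = n * (n * 2).
Proof.
rewrite sgraph_codeE (@size_flatten_const _ _ _ (n * 2)) ?size_enum_ord // => i.
by rewrite (@size_flatten_const _ _ _ 2) ?size_enum_ord // => j; apply: size_edge_code.
Qed.

Lemma sgraph_code_inj n (G G' : sgraph 'I_n) :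
  sgraph_code G = sgraph_code G' -> sedge G =2 sedge G'.
Proof.
rewrite !sgraph_codeE => /flatten_map_inj h i j.
have sz (H : sgraph 'I_n) i' :
    size (flatten [seq edge_code (sedge H i' j) | j <- enum 'I_n]) = n * 2.
  by rewrite (@size_flatten_const _ _ _ 2) ?size_enum_ord // => ?; apply: size_edge_code.
have /flatten_map_inj h' := h (fun i' => etrans (sz G i') (esym (sz G' i'))) i (mem_enum _ i).
have := h' (fun j' => etrans (size_edge_code _) (esym (size_edge_code _))) j (mem_enum _ j).
by case: (sedge G i j) => [[]|]; case: (sedge G' i j) => [[]|].
Qed.

Lemma has_complete_ext (T : finType) (G G' : sgraph T) k :
  sedge G =2 sedge G' -> has_complete G k -> has_complete G' k.
Proof.
move=> e [H [[S hS] hphi]]; exists H; split=> //; exists S => x y.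
by rewrite hS /= /switch_edge e.
Qed.

(** The length of the matrix code determines the order. The graphs have different types until then,
    so they are compared through [has_complete]. *)
Lemma instance_code_inj n n' (G : sgraph 'I_n) (G' : sgraph 'I_n') k k' :
  instance_code G k = instance_code G' k' ->
  k = k' /\ forall l, has_complete G l -> has_complete G' l.
Proof.
case/pair_code_inj=> /(can_inj nat_codeK) -> e; split=> //.
have en : n = n' by have := congr1 size e; rewrite !size_sgraph_code; nia.
by subst n' => l; apply: has_complete_ext; exact: sgraph_code_inj.
Qed.

Lemma san_gadget m V lit : 0 < V ->
  SIGNED_ACHROMATIC_NUMBER (instance_code (gadget m V lit) (gorder m V))
  <-> satisfiable m V lit.
Proof.
move=> V0; split.
  case=> n [G [k [_ /esym /instance_code_inj[-> hG] [l [[_ hl _] kl]]]]].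
  by have [_] := complete_gadget_sat V0 kl (hG _ hl).
move=> hs; exists (gorder m V), (gadget m V lit), (gorder m V); split=> //.
exists (gorder m V); split=> //; split=> //; first exact: sat_complete_gadget.
(* More colours than vertices are impossible, so the achromatic number is exactly the order. *)
move=> k _ hk; case: (leqP k (gorder m V)) => // h.
by have [e _] := complete_gadget_sat V0 (ltnW h) hk; rewrite e ltnn in h.
Qed.

(** * NP-hardness *)

Lemma horner_nat_mono (p : {poly nat}) a b : a <= b -> p.[a]%R <= p.[b]%R.
Proof.
move=> hab; elim/poly_ind: p => [|p c IH]; first by rewrite !horner0.
rewrite !hornerMXaddC; exact: leq_add (leq_mul IH hab) (leqnn c).
Qed.

Theorem theorem4p3 : NP_hard SIGNED_ACHROMATIC_NUMBER.
Proof.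
move=> L [V [p [[f [[M [q hM]] hV]] hL]]].
pose cert n := p.[n]%R.
(* [Bf] exceeds the input cells including the longest certificate, and also the running time on any
   such input. *)
pose Bf n := q.[n.*2.+2 + cert n]%R + (n.*2.+2 + cert n).+1.
have pcert : is_poly cert by exists p.
have pdbl : is_poly (fun n => n.*2.+2 + cert n).
  apply: is_poly_add => //; apply: (@is_poly_ext (fun n => n + n + 2)).
    by move=> n; rewrite addnn addn2.
  by apply: is_poly_add (is_poly_cst 2); apply: is_poly_add; apply: is_poly_id.
have pBf : is_poly Bf.
  apply: is_poly_add.
    by apply: (@is_poly_comp (fun n => q.[n]%R)) pdbl; exists q.
  apply: (@is_poly_ext (fun n => n.*2.+2 + cert n + 1)) => [n|]; first by rewrite addn1.
  exact: is_poly_add pdbl (is_poly_cst 1).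
have hB (x : seq bool) : (size x).*2.+2 + cert (size x) < Bf (size x) by rewrite /Bf; lia.
pose m := nclauses M Bf; pose W := nvars M Bf; pose lit := @clause_at M cert Bf.
exists (fun x => instance_code (gadget (m x) (W x) (lit x)) (gorder (m x) (W x))).
split.
  apply: polytime_instance.
  - by rewrite /m /nclauses; def_tac.
  - by rewrite /W /nvars; def_tac.
  - by move=> c v b hc hv hb; apply: def_clause_at.
move=> x; have san := san_gadget (m x) (lit x) (nvars_gt0 M (hB x)).
have acc u : size u <= cert (size x) ->
    cf_tape (run M x u (Bf (size x)).-1) ord_max 0 = Some (inl (f (pair_code x u))).
  move=> hu; set w := pair_code x u.
  have hw : q.[size w]%R <= (Bf (size x)).-1.
    apply: leq_trans (horner_nat_mono q _) _; last first.
      by rewrite /Bf addnS /=; apply: leq_addr.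
    by rewrite size_pair_code leq_add2l.
  have [hh ho] := hM w.
  rewrite /run -/w -(subnK hw) iterD.
  set c := iter q.[size w]%R _ _ in hh ho *.
  (* The output is inspected at time [Bf - 1], possibly after the time bound of the verifier; halted
     configurations do not change. *)
  have fix_c k : iter k (@tm_step M) c = c.
    by elim: k => //= k ->; rewrite /tm_step hh.
  by rewrite fix_c (ho 0).
split.
  move/hL=> [u [hu /hV hf]]; apply/san; apply: (accepting_sat (hB x) hu).
  by rewrite acc // hf.
move/san/(sat_accepting (hB x))=> [u hu]; rewrite acc // => -[hf].
by apply/hL; exists u; split=> //; apply/hV; rewrite hf.
Qed.
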